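(* Let $k$ be a field. Every object in the abelian category $\mathscr C\text{-mod}^{\mathrm{sa}}$ of finitely generated saturated $\mathscr C$-modules is of finite length and of finite injective dimension.
   Context: $\mathscr C$ is the category with objects $[n]=\{1,\dots,n\}$, $n\in\mathbb N=\{0,1,\dots\}$, $[0]=\emptyset$, and strictly increasing maps as morphisms. A $\mathscr C$-module is a functor $V:\mathscr C\to k\text{-Mod}$, $V_n=V([n])$; it is finitely generated if it is a quotient of a finite direct sum of modules $M(n)=k\mathscr C([n],-)$. $\mathscr C\text{-mod}$ is the (abelian) category of finitely generated $\mathscr C$-modules. An element $v\in V_n$ is torsion if $\alpha\cdot v=0$ for some morphism $\alpha:[n]\to[n+s]$; $V$ is torsion if all its elements $v\in V_n$, $n\in\mathbb N$, are torsion; $\mathscr C\text{-mod}^{\mathrm{tor}}$ is the category of finitely generated torsion modules. $V$ is saturated if $\mathrm{Hom}(T,V)=0=\mathrm{Ext}^1(T,V)$ for every torsion $\mathscr C$-module $T$. Let $\mathrm{loc}:\mathscr C\text{-mod}\to\mathscr C\text{-mod}/\mathscr C\text{-mod}^{\mathrm{tor}}$ be the localization functor and $\mathrm{sec}$ its right adjoint. They restrict to an equivalence between the full subcategory $\mathscr C\text{-mod}^{\mathrm{sa}}$ of finitely generated saturated modules and the Serre quotient $\mathscr C\text{-mod}/\mathscr C\text{-mod}^{\mathrm{tor}}$, and $\mathscr C\text{-mod}^{\mathrm{sa}}$ carries the corresponding abelian structure: kernels are as in $\mathscr C\text{-mod}$, and the cokernel of $\alpha:V\to W$ is $(\mathrm{sec}\circ\mathrm{loc})(W/\alpha(V))$.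 Length and injective dimension are taken in this abelian category. *)

(* Defs.v *)
From HB Require Import structures.
From mathcomp Require Import all_boot all_order all_algebra.

Set Implicit Arguments.
Unset Strict Implicit.
Unset Printing Implicit Defensive.

Import Order.TTheory GRing.Theory Num.Theory.
Local Open Scope ring_scope.

(* The object [n] = {1,...,n} is represented by 'I_n = {0,...,n-1}.           *)

Definition incr (m n : nat) : Type :=
  {f : {ffun 'I_m -> 'I_n} |
    [forall i : 'I_m, forall j : 'I_m, (i < j)%N ==> (f i < f j)%N]}.

HB.instance Definition _ m n := Finite.on (incr m n).

Definition incr_fun m n (f : incr m n) : 'I_m -> 'I_n := val f.
Coercion incr_fun : incr >-> Funclass.

Lemma incrP m n (f : incr m n) (i j : 'I_m) : (i < j)%N -> (f i < f j)%N.
Proof. by move=> ij; have /forallP/(_ i)/forallP/(_ j)/implyP := valP f; apply. Qed.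

Lemma incr_eqP m n (f g : incr m n) : f =1 g -> f = g.
Proof. by move=> fg; apply/val_inj/ffunP => i; apply: fg. Qed.

Lemma incr_id_subproof n :
  [forall i : 'I_n, forall j : 'I_n, (i < j)%N ==>
    ([ffun x : 'I_n => x] i < [ffun x : 'I_n => x] j)%N].
Proof. by apply/forallP => i; apply/forallP => j; apply/implyP; rewrite !ffunE. Qed.

Definition incr_id n : incr n n := exist _ [ffun x => x] (incr_id_subproof n).

Lemma incr_comp_subproof m n p (g : incr n p) (f : incr m n) :
  [forall i : 'I_m, forall j : 'I_m, (i < j)%N ==>
    ([ffun x : 'I_m => g (f x)] i < [ffun x : 'I_m => g (f x)] j)%N].
Proof.
apply/forallP => i; apply/forallP => j; apply/implyP => ij.
by rewrite !ffunE; do 2!apply: incrP.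
Qed.

Definition incr_comp m n p (g : incr n p) (f : incr m n) : incr m p :=
  exist _ [ffun x => g (f x)] (incr_comp_subproof g f).

Lemma incr_idE n (i : 'I_n) : incr_id n i = i.
Proof. by rewrite /incr_fun /= ffunE. Qed.

Lemma incr_compE m n p (g : incr n p) (f : incr m n) i :
  incr_comp g f i = g (f i).
Proof. by rewrite {1}/incr_fun /= ffunE. Qed.

Lemma incr_comp1f m n (f : incr m n) : incr_comp (incr_id n) f = f.
Proof. by apply: incr_eqP => i; rewrite incr_compE incr_idE. Qed.

Lemma incr_compA m n p q (h : incr p q) (g : incr n p) (f : incr m n) :
  incr_comp (incr_comp h g) f = incr_comp h (incr_comp g f).
Proof. by apply: incr_eqP => i; rewrite !incr_compE. Qed.

Record Cmod (k : fieldType) := MkCmod {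
  ob :> nat -> lmodType k;
  act : forall m n, incr m n -> {linear ob m -> ob n};
  act_id : forall n (x : ob n), act (incr_id n) x = x;
  act_comp : forall m n p (g : incr n p) (f : incr m n) (x : ob m),
    act (incr_comp g f) x = act g (act f x)
}.
Arguments act {k} _ {m n} _.

Record hom (k : fieldType) (V W : Cmod k) := MkHom {
  hom_fun :> forall n, {linear V n -> W n};
  hom_nat : forall m n (a : incr m n) (x : V m),
    hom_fun n (act V a x) = act W a (hom_fun m x)
}.

Definition hom_eq (k : fieldType) (V W : Cmod k) (f g : hom V W) : Prop :=
  forall n (x : V n), f n x = g n x.

Lemma id_nat (k : fieldType) (V : Cmod k) m n (a : incr m n) (x : V m) :
  (idfun : {linear V n -> V n}) (act V a x) =
  act V a ((idfun : {linear V m -> V m}) x).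
Proof. by []. Qed.

Definition hom_id (k : fieldType) (V : Cmod k) : hom V V :=
  MkHom (@id_nat k V).

Lemma comp_nat (k : fieldType) (U V W : Cmod k) (g : hom V W) (f : hom U V)
    m n (a : incr m n) (x : U m) :
  (g n \o f n : {linear U n -> W n}) (act U a x) =
  act W a ((g m \o f m : {linear U m -> W m}) x).
Proof. by rewrite /= !hom_nat. Qed.

Definition hom_comp (k : fieldType) (U V W : Cmod k) (g : hom V W) (f : hom U V)
  : hom U W := MkHom (comp_nat g f).

Definition is_zero_hom (k : fieldType) (V W : Cmod k) (f : hom V W) : Prop :=
  forall n (x : V n), f n x = 0.

(* M(d) = k C([d], -): an element of k C([d], [n]) is its coefficient family. *)
Section Principal.
Variables (k : fieldType) (d : nat).

Definition principal_act m n (a : incr m n) (c : {ffun incr d m -> k^o}) :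
    {ffun incr d n -> k^o} :=
  [ffun g : incr d n => \sum_(f : incr d m | incr_comp a f == g) c f].

Lemma principal_act_linear m n (a : incr m n) : linear (principal_act a).
Proof.
move=> c x y; apply/ffunP => g; rewrite !ffunE scaler_sumr -big_split /=.
by apply: eq_bigr => f _; rewrite !ffunE.
Qed.

HB.instance Definition _ m n (a : incr m n) :=
  GRing.isLinear.Build k {ffun incr d m -> k^o} {ffun incr d n -> k^o} _
    (principal_act a) (principal_act_linear a).

Lemma principal_act_id n (x : {ffun incr d n -> k^o}) :
  principal_act (incr_id n) x = x.
Proof.
apply/ffunP => g; rewrite ffunE.
rewrite (eq_bigl (pred1 g)) ?big_pred1_eq // => f /=.
by rewrite incr_comp1f.
Qed.

Lemma principal_act_comp m n p (g : incr n p) (f : incr m n)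
    (x : {ffun incr d m -> k^o}) :
  principal_act (incr_comp g f) x = principal_act g (principal_act f x).
Proof.
apply/ffunP => h; rewrite !ffunE.
under [RHS]eq_bigr => i _ do rewrite ffunE.
rewrite (exchange_big_dep (fun j => incr_comp (incr_comp g f) j == h)) /=; last first.
  by move=> i j /eqP <- /eqP <-; rewrite incr_compA.
apply: eq_bigr => j /eqP hj.
rewrite (big_pred1 (incr_comp f j)) // => i /=.
rewrite [_ == i]eq_sym andbC; case: eqP => //= ->.
by rewrite -incr_compA hj eqxx.
Qed.

Definition principal : Cmod k :=
  @MkCmod k (fun n => {ffun incr d n -> k^o})
    (fun m n a => principal_act a : {linear _ -> _})
    principal_act_id principal_act_comp.
End Principal.

Section DirectSum.
Variables (k : fieldType) (V W : Cmod k).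

Definition dsum_act m n (a : incr m n) (x : (V m * W m)%type) :
  (V n * W n)%type := (act V a x.1, act W a x.2).

Lemma dsum_act_linear m n (a : incr m n) : linear (dsum_act a).
Proof. by move=> c x y; rewrite /dsum_act /= !linearP. Qed.

HB.instance Definition _ m n (a : incr m n) :=
  GRing.isLinear.Build k (V m * W m)%type (V n * W n)%type _
    (dsum_act a) (dsum_act_linear a).

Lemma dsum_act_id n (x : (V n * W n)%type) : dsum_act (incr_id n) x = x.
Proof. by case: x => x y; rewrite /dsum_act /= !act_id. Qed.

Lemma dsum_act_comp m n p (g : incr n p) (f : incr m n)
    (x : (V m * W m)%type) :
  dsum_act (incr_comp g f) x = dsum_act g (dsum_act f x).
Proof. by rewrite /dsum_act /= !act_comp. Qed.

Definition dsum : Cmod k :=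
  @MkCmod k (fun n => (V n * W n)%type)
    (fun m n a => dsum_act a : {linear _ -> _}) dsum_act_id dsum_act_comp.
End DirectSum.

Definition zero_mod (k : fieldType) : Cmod k :=
  @MkCmod k (fun _ => 'rV[k]_0)
    (fun _ _ _ => idfun : {linear 'rV[k]_0 -> 'rV[k]_0})
    (fun _ _ => erefl) (fun _ _ _ _ _ _ => erefl).

Definition principal_sum (k : fieldType) (s : seq nat) : Cmod k :=
  foldr (fun d V => dsum (principal k d) V) (zero_mod k) s.

Definition finitely_generated (k : fieldType) (V : Cmod k) : Prop :=
  exists (s : seq nat) (f : hom (principal_sum k s) V),
    forall n (y : V n), exists x, f n x = y.

Definition torsion_elt (k : fieldType) (V : Cmod k) n (v : V n) : Prop :=
  exists (s : nat) (a : incr n (n + s)), act V a v = 0.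

Definition torsion (k : fieldType) (V : Cmod k) : Prop :=
  forall n (v : V n), torsion_elt v.

Definition Hom_zero (k : fieldType) (T V : Cmod k) : Prop :=
  forall f : hom T V, is_zero_hom f.

(* Exactness of 0 -> V -> E -> T -> 0 in the category of all C-modules, where *)
(* it is checked objectwise.                                                  *)
Definition is_extension (k : fieldType) (V E T : Cmod k)
    (i : hom V E) (p : hom E T) : Prop :=
  [/\ forall n, injective (i n),
      forall n (y : T n), exists x, p n x = y &
      forall n (x : E n), p n x = 0 <-> exists v, i n v = x].

(* Ext^1 in the sense of Yoneda, in the category of all C-modules.            *)
Definition Ext1_zero (k : fieldType) (T V : Cmod k) : Prop :=
  forall (E : Cmod k) (i : hom V E) (p : hom E T), is_extension i p ->
    exists s : hom T E, hom_eq (hom_comp p s) (hom_id T).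

Definition saturated (k : fieldType) (V : Cmod k) : Prop :=
  forall T : Cmod k, torsion T -> Hom_zero T V /\ Ext1_zero T V.

(* The category of finitely generated saturated C-modules is a full           *)
(* subcategory of C-modules: its morphisms are the [hom]s. In the notions     *)
(* below every test object ranges over this subcategory, so that kernels,     *)
(* cokernels, monos and epis are those of this abelian category. In           *)
(* particular cokernels, hence epimorphisms and exactness, are not computed   *)
(* objectwise: the cokernel of V -> W is the saturation of W / im V.          *)
Record sa_mod (k : fieldType) := MkSaMod {
  sa_cmod :> Cmod k;
  sa_fg : finitely_generated sa_cmod;
  sa_sat : saturated sa_cmod
}.

Section SaCategory.
Variable k : fieldType.
Implicit Types A B C D I K S V X : sa_mod k.

Definition is_zero X : Prop := is_zero_hom (hom_id X).

Definition is_iso A B (f : hom A B) : Prop :=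
  exists g : hom B A,
    hom_eq (hom_comp g f) (hom_id A) /\ hom_eq (hom_comp f g) (hom_id B).

Definition is_mono A B (f : hom A B) : Prop :=
  forall X (u v : hom X A),
    hom_eq (hom_comp f u) (hom_comp f v) -> hom_eq u v.

Definition is_epi A B (f : hom A B) : Prop :=
  forall X (u v : hom B X),
    hom_eq (hom_comp u f) (hom_comp v f) -> hom_eq u v.

Definition is_kernel K A B (f : hom A B) (i : hom K A) : Prop :=
  is_zero_hom (hom_comp f i) /\
  forall X (u : hom X A), is_zero_hom (hom_comp f u) ->
    exists v : hom X K, hom_eq (hom_comp i v) u /\
      forall w : hom X K, hom_eq (hom_comp i w) u -> hom_eq w v.

Definition is_cokernel A B C (f : hom A B) (p : hom B C) : Prop :=
  is_zero_hom (hom_comp p f) /\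
  forall X (u : hom B X), is_zero_hom (hom_comp u f) ->
    exists v : hom C X, hom_eq (hom_comp v p) u /\
      forall w : hom C X, hom_eq (hom_comp w p) u -> hom_eq w v.

Definition short_exact A B C (i : hom A B) (p : hom B C) : Prop :=
  is_kernel p i /\ is_cokernel i p.

(* f factors as an epimorphism onto the kernel of g, i.e. im f = ker g.       *)
Definition exact_at A B C (f : hom A B) (g : hom B C) : Prop :=
  exists (K : sa_mod k) (i : hom K B) (e : hom A K),
    [/\ is_kernel g i, is_epi e & hom_eq f (hom_comp i e)].

Definition simple_object S : Prop :=
  ~ is_zero S /\
  forall A (i : hom A S), is_mono i -> is_zero A \/ is_iso i.

(* Existence of a finite filtration with simple subquotients.                 *)
Inductive finite_length : sa_mod k -> Prop :=
| finite_length_zero X : is_zero X -> finite_length X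
| finite_length_step A X S (i : hom A X) (p : hom X S) :
    short_exact i p -> simple_object S -> finite_length A -> finite_length X.

Definition injective_object I : Prop :=
  forall A B (i : hom A B) (f : hom A I), is_mono i ->
    exists g : hom B I, hom_eq (hom_comp g i) f.

(* There is an injective resolution 0 -> V -> I 0 -> ... -> I d -> 0; beyond  *)
(* degree d it is continued by zero objects.                                  *)
Definition finite_injective_dimension V : Prop :=
  exists (d : nat) (I : nat -> sa_mod k)
         (eps : hom V (I 0%N)) (del : forall j, hom (I j) (I j.+1)),
    [/\ forall j, injective_object (I j),
        is_mono eps,
        exact_at eps (del 0%N),
        forall j, exact_at (del j) (del j.+1) &
        forall j, (d < j)%N -> is_zero (I j)].

End SaCategory.

(* Main.v *)
From HB Require Import structures.
From mathcomp Require Import all_boot all_order all_algebra.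
From mathcomp Require Import boolp zify.
Require Import Defs.

(** Write [M(d)] for the principal module at [d]. Its elements are chains of
    increasing maps with source [[d]], on which maps [q : [e] -> [d]] act from
    the right ([rcomp]); the chains killed by all [q] with [e < d] form the
    submodule [S(d)] ([socle]). The proof rests on two facts.

    _[S(d)] is simple up to torsion_ ([socle_dense]). A nonzero chain [y] in
    [M(d)] generates the product of the differences of consecutive points
    ([cube]): double the points of one map in the support of [y], and take an
    alternating sum. Conversely a chain of [S(d)], with its points doubled, is
    a combination of images of the cube ([socle_expansion]), since all the
    other terms of this combination are governed by faces of the chain, which
    vanish.

    _[M(d)] is injective relative to finitely generated modules_ ([extend_hom]).
    Extending a morphism over one more generator means solving finitely many
    linear equations in [M(d)], all of them in one degree [N], because [M(n)] is
    noetherian: its leading terms for the lexicographic order obey Dickson's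
    lemma ([noetherian_principal]). If there is no solution, linear algebra
    gives a functional that kills the left hand sides, with all their
    restrictions, but not the right hand sides. This functional is turned into a
    linear relation between translates of the equations, and hence into a
    contradiction, by mapping the part of degree at most [N] of an injective
    right module to the right module [k C(-, [K])] for some large [K]
    ([dual_family]). Such a map is built one degree at a time, which is possible because compatible families
    of faces can be filled after enlarging [K] ([filling]).

    The restrictions along the faces of [d], in order of increasing size, filter
    [M(d)] with steps contained in some [S(e)] ([tower_principal]). Together with
    the two facts this shows that any closed submodule of a finitely generated
    module is the common kernel of finitely many morphisms to principal modules
    ([cogeneration]). In particular a finitely generated torsion free module
    embeds in a finite sum of principal modules, and it is saturated exactly if
    it satisfies descent ([sheaf_saturated], [saturated_sheaf]). Intersecting
    with the filtration of the sum, a saturated module is exhausted by steps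
    that are zero or dense in a simple object [S(e)], so it has finite length.

    For the injective dimension, embed [V] in a sum of principal modules, embed
    the cokernel in another one, and so on, using a minimal family of morphisms
    each time. The functor [Hom(-, M(e))] turns this into a minimal projective
    resolution of a right module of finite dimension; by minimality the largest
    [e] for which the cokernel has a nonzero morphism to [M(e)] decreases at
    each step ([resolution_step]), so the resolution stops. *)

Set Implicit Arguments.
Unset Strict Implicit.
Unset Printing Implicit Defensive.

Import Order.TTheory GRing.Theory Num.Theory.
Local Open Scope ring_scope.


(** * Submodules, quotients and morphisms given by graphs *)

Definition linear_of (k : fieldType) (U V : lmodType k) (f : U -> V)
    (fl : linear f) : {linear U -> V} :=
  HB.pack f (GRing.isLinear.Build k U V _ f fl).

Section LinearMaps.
Variables (k : fieldType) (V W : Cmod k).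

Lemma hom0 (h : hom V W) n : h n 0 = 0. Proof. exact: linear0. Qed.
Lemma homD (h : hom V W) n : {morph h n : x y / x + y}. Proof. exact: linearD. Qed.
Lemma homB (h : hom V W) n : {morph h n : x y / x - y}. Proof. exact: linearB. Qed.
Lemma homZ (h : hom V W) n c (x : V n) : h n (c *: x) = c *: h n x.
Proof. exact: linearZ. Qed.
Lemma hom_sum (h : hom V W) n (I : Type) (r : seq I) (Q : pred I) (F : I -> V n) :
  h n (\sum_(i <- r | Q i) F i) = \sum_(i <- r | Q i) h n (F i).
Proof. exact: linear_sum. Qed.

Section Act.
Variables (m n : nat) (a : incr m n).
Lemma act0 : act V a 0 = 0. Proof. exact: linear0. Qed.
Lemma actB : {morph act V a : x y / x - y}. Proof. exact: linearB. Qed.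
Lemma actZ c (x : V m) : act V a (c *: x) = c *: act V a x.
Proof. exact: linearZ. Qed.
Lemma act_sum (I : Type) (r : seq I) (Q : pred I) (F : I -> V m) :
  act V a (\sum_(i <- r | Q i) F i) = \sum_(i <- r | Q i) act V a (F i).
Proof. exact: linear_sum. Qed.
End Act.

End LinearMaps.

Arguments ob : simpl never.
Arguments act : simpl never.
Arguments hom_fun : simpl never.

Lemma hom_compE (k : fieldType) (U V W : Cmod k) (g : hom V W) (f : hom U V) n x :
  hom_comp g f n x = g n (f n x).
Proof. by []. Qed.

Lemma hom_idE (k : fieldType) (V : Cmod k) n x : hom_id V n x = x.
Proof. by []. Qed.

Section Submodules.
Variables (k : fieldType) (V : Cmod k).
Implicit Types P Q : forall n, V n -> Prop.

Definition is_subm P : Prop :=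
  [/\ forall n, P n 0,
      forall n c (x y : V n), P n x -> P n y -> P n (c *: x + y) &
      forall m n (a : incr m n) (x : V m), P m x -> P n (act V a x)].

Variables (P : forall n, V n -> Prop) (sP : is_subm P).

Lemma subm0 n : P (0 : V n). Proof. by case: sP. Qed.

Lemma subm_act m n (a : incr m n) (x : V m) : P x -> P (act V a x).
Proof. by case: sP => _ _; apply. Qed.

Lemma subm_lin n c (x y : V n) : P x -> P y -> P (c *: x + y).
Proof. by case: sP => _ + _; apply. Qed.

Lemma submZ n c (x : V n) : P x -> P (c *: x).
Proof. by move=> Px; rewrite -[_ *: _]addr0; apply: subm_lin => //; apply: subm0. Qed.

Lemma submD n (x y : V n) : P x -> P y -> P (x + y).
Proof. by move=> Px Py; rewrite -[x]scale1r; apply: subm_lin. Qed.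

Lemma submN n (x : V n) : P x -> P (- x).
Proof. by rewrite -scaleN1r; apply: submZ. Qed.

Lemma submB n (x y : V n) : P x -> P y -> P (x - y).
Proof. by move=> Px Py; apply: submD => //; apply: submN. Qed.

Lemma subm_sum n (I : Type) (r : seq I) (Q : pred I) (F : I -> V n) :
  (forall i, Q i -> P (F i)) -> P (\sum_(i <- r | Q i) F i).
Proof. by move=> PF; elim/big_ind: _ => //; [apply: subm0 | apply: submD]. Qed.

End Submodules.

Section SubCmod.
Variables (k : fieldType) (V : Cmod k) (P : forall n, V n -> Prop).
Hypothesis sP : is_subm P.

Definition subm_pred (_ : is_subm P) n : pred (V n) := fun x => `[< P x >].

Lemma subm_pred_closed n : submod_closed (@subm_pred sP n).
Proof.
split; first by apply/asboolP; apply: subm0.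
by move=> c x y /asboolP Px /asboolP Py; apply/asboolP; apply: subm_lin.
Qed.

HB.instance Definition _ n :=
  GRing.isSubmodClosed.Build k (V n) (@subm_pred sP n) (@subm_pred_closed n).

Definition sub_ob n : Type := {x : V n | x \in @subm_pred sP n}.
HB.instance Definition _ n := SubType.on (sub_ob n).
HB.instance Definition _ n := Choice.on (sub_ob n).
HB.instance Definition _ n := [SubChoice_isSubLmodule of sub_ob n by <:].

Lemma sub_obP n (x : sub_ob n) : P (val x).
Proof. exact/asboolP/(valP x). Qed.

Definition sub_mk n (x : V n) (Px : P x) : sub_ob n :=
  exist _ x (introT (asboolP _) Px).

Definition sub_act m n (a : incr m n) (x : sub_ob m) : sub_ob n :=
  sub_mk (subm_act sP a (sub_obP x)).

Lemma sub_act_linear m n (a : incr m n) : linear (@sub_act m n a).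
Proof. by move=> c x y; apply/val_inj; rewrite /= !linearP. Qed.

Lemma sub_act_id n (x : sub_ob n) : sub_act (incr_id n) x = x.
Proof. by apply/val_inj; rewrite /= act_id. Qed.

Lemma sub_act_comp m n p (g : incr n p) (f : incr m n) (x : sub_ob m) :
  sub_act (incr_comp g f) x = sub_act g (sub_act f x).
Proof. by apply/val_inj; rewrite /= act_comp. Qed.

Definition sub_cmod : Cmod k :=
  @MkCmod k (fun n => sub_ob n)
    (fun m n a => linear_of (@sub_act_linear m n a)) sub_act_id sub_act_comp.

Lemma sub_val_linear n : linear (val : sub_ob n -> V n).
Proof. by []. Qed.

Lemma sub_val_nat m n (a : incr m n) (x : sub_cmod m) :
  linear_of (@sub_val_linear n) (act sub_cmod a x) =
  act V a (linear_of (@sub_val_linear m) x).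
Proof. by []. Qed.

Definition sub_incl : hom sub_cmod V := MkHom sub_val_nat.

Lemma sub_incl_inj n : injective (sub_incl n).
Proof. exact: val_inj. Qed.

Lemma sub_inclP n (x : sub_cmod n) : P (sub_incl n x).
Proof. exact: sub_obP. Qed.

Lemma sub_incl_surj n (x : V n) : P x -> exists y, sub_incl n y = x.
Proof. by move=> Px; exists (sub_mk Px). Qed.

End SubCmod.

Section QuotCmod.
Local Open Scope quotient_scope.
Variables (k : fieldType) (V : Cmod k) (P : forall n, V n -> Prop).
Hypothesis sP : is_subm P.

Definition quot_ob n : Type :=
  Quotient.quot (HB.pack (subm_pred sP (n:=n)) : zmodClosed (V n)).
HB.instance Definition _ n := GRing.Zmodule.on (quot_ob n).

Definition quot_pi n (x : V n) : quot_ob n := \pi_(quot_ob n) x.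

Lemma quot_piD n (x y : V n) : quot_pi (x + y) = quot_pi x + quot_pi y.
Proof. by rewrite /quot_pi !piE. Qed.

Lemma quot_pi_eq n (x y : V n) : quot_pi x = quot_pi y <-> P (x - y).
Proof.
split=> [/eqP|Pxy]; last apply/eqP.
  by rewrite /quot_pi -Quotient.idealrBE => /asboolP.
by rewrite /quot_pi -Quotient.idealrBE; apply/asboolP.
Qed.

Lemma quot_pi_surj n (x : quot_ob n) : exists y, quot_pi y = x.
Proof. by exists (repr x); apply: reprK. Qed.

Definition quot_scale n c (x : quot_ob n) : quot_ob n := quot_pi (c *: repr x).

Lemma quot_piZ n c (x : V n) : quot_scale c (quot_pi x) = quot_pi (c *: x).
Proof.
apply/quot_pi_eq; rewrite -scalerBr; apply: submZ => //.
by apply/quot_pi_eq; apply: reprK.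
Qed.

Lemma quot_scaleA n a b (x : quot_ob n) :
  quot_scale a (quot_scale b x) = quot_scale (a * b) x.
Proof. by have [y <-] := quot_pi_surj x; rewrite !quot_piZ scalerA. Qed.

Lemma quot_scale1 n : left_id 1 (@quot_scale n).
Proof. by move=> x; have [y <-] := quot_pi_surj x; rewrite quot_piZ scale1r. Qed.

Lemma quot_scaleDr n : right_distributive (@quot_scale n) +%R.
Proof.
move=> c x y; have [x' <-] := quot_pi_surj x; have [y' <-] := quot_pi_surj y.
by rewrite -quot_piD !quot_piZ scalerDr quot_piD.
Qed.

Lemma quot_scaleDl n (x : quot_ob n) : {morph (@quot_scale n)^~ x : a b / a + b}.
Proof.
move=> a b; have [x' <-] := quot_pi_surj x.
by rewrite !quot_piZ scalerDl quot_piD.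
Qed.

HB.instance Definition _ n := GRing.Zmodule_isLmodule.Build k (quot_ob n)
  (@quot_scaleA n) (@quot_scale1 n) (@quot_scaleDr n) (@quot_scaleDl n).

Lemma quot_pi_linear n : linear (@quot_pi n).
Proof. by move=> c x y; rewrite quot_piD -quot_piZ. Qed.

Definition quot_act m n (a : incr m n) (x : quot_ob m) : quot_ob n :=
  quot_pi (act V a (repr x)).

Lemma quot_pi_act m n (a : incr m n) (x : V m) :
  quot_act a (quot_pi x) = quot_pi (act V a x).
Proof.
apply/quot_pi_eq; rewrite -linearB; apply: subm_act => //.
by apply/quot_pi_eq; apply: reprK.
Qed.

Lemma quot_act_linear m n (a : incr m n) : linear (@quot_act m n a).
Proof.
move=> c x y; have [x' <-] := quot_pi_surj x; have [y' <-] := quot_pi_surj y.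
by rewrite -quot_pi_linear !quot_pi_act linearP quot_pi_linear.
Qed.

Lemma quot_act_id n (x : quot_ob n) : quot_act (incr_id n) x = x.
Proof. by have [y <-] := quot_pi_surj x; rewrite quot_pi_act act_id. Qed.

Lemma quot_act_comp m n p (g : incr n p) (f : incr m n) (x : quot_ob m) :
  quot_act (incr_comp g f) x = quot_act g (quot_act f x).
Proof. by have [y <-] := quot_pi_surj x; rewrite !quot_pi_act act_comp. Qed.

Definition quot_cmod : Cmod k :=
  @MkCmod k (fun n => quot_ob n)
    (fun m n a => linear_of (@quot_act_linear m n a)) quot_act_id quot_act_comp.

Lemma quot_proj_nat m n (a : incr m n) (x : V m) :
  linear_of (@quot_pi_linear n) (act V a x) =
  act quot_cmod a (linear_of (@quot_pi_linear m) x).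
Proof. by rewrite /= quot_pi_act. Qed.

Definition quot_proj : hom V quot_cmod := @MkHom k V quot_cmod _ quot_proj_nat.

Lemma quot_proj_surj n (y : quot_cmod n) : exists x, quot_proj n x = y.
Proof. exact: quot_pi_surj. Qed.

Lemma quot_proj_eq0 n (x : V n) : quot_proj n x = 0 <-> P x.
Proof. by rewrite -(linear0 (quot_proj n)) quot_pi_eq subr0. Qed.

End QuotCmod.

(** A morphism is determined by its graph, and any submodule of [V + W] that is
    total and functional over [V] is a graph: most morphisms below are built
    in this way. *)
Section Graphs.
Variables (k : fieldType) (V W : Cmod k) (G : forall n, dsum V W n -> Prop).

Definition functional := forall n (y : W n), G (0, y) -> y = 0.
Definition total := forall n (x : V n), exists y, G (x, y).

Lemma functional_inj : is_subm G -> functional ->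
  forall n (x : V n) y y', G (x, y) -> G (x, y') -> y = y'.
Proof.
move=> sG fG n x y y' Gy Gy'; apply/eqP; rewrite -subr_eq0; apply/eqP/fG.
by have := submB sG Gy Gy'; rewrite -[(_, _) - _]/(x - x, y - y') subrr.
Qed.

Lemma graph_hom : is_subm G -> functional -> total ->
  exists h : hom V W, forall n x y, G (x, y) <-> h n x = y.
Proof.
move=> sG fG tG.
pose h n (x : V n) : W n := projT1 (cid (tG n x)).
have Gh n x : G (x, h n x) by apply: projT2 (cid (tG n x)).
have hE n x y : G (x, y) -> h n x = y by apply: functional_inj.
have hl n : linear (h n).
  by move=> c x y; apply: hE; apply: (subm_lin sG c (Gh n x) (Gh n y)).
have hn m n (a : incr m n) x :
    linear_of (hl n) (act V a x) = act W a (linear_of (hl m) x).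
  by apply: hE; apply: (subm_act sG a (Gh m x)).
by exists (MkHom hn) => n x y; split=> [/hE|<-].
Qed.

End Graphs.

Lemma sub_lift (k : fieldType) (V W : Cmod k) (P : forall n, W n -> Prop)
    (sP : is_subm P) (u : hom V W) : (forall n x, P n (u n x)) ->
  exists v : hom V (sub_cmod sP), forall n x, sub_incl sP n (v n x) = u n x.
Proof.
move=> Pu; pose i := sub_incl sP.
pose G n (x : dsum V (sub_cmod sP) n) := i n x.2 = u n x.1.
have sG : is_subm G.
  split=> [n|n c x y xE yE|m n a x xE].
  - by have : i n 0 = u n 0 by rewrite !hom0.
  - have : i n (c *: x.2 + y.2) = u n (c *: x.1 + y.1).
      by rewrite !homD !homZ xE yE.
    by [].
  - by have : i n (act _ a x.2) = u n (act _ a x.1) by rewrite !hom_nat xE.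
have [n y Gy|n x|v vE] := graph_hom sG.
- by apply: (@sub_incl_inj _ _ _ sP); rewrite hom0 -(hom0 u).
- by have [y yE] := sub_incl_surj sP (Pu n x); exists y.
- by exists v => n x; apply/vE.
Qed.

Section HomOps.
Variable k : fieldType.
Implicit Types U V W : Cmod k.

Lemma zero_hom_nat V W m n (a : incr m n) (x : V m) :
  (GRing.null_fun _ : {linear V n -> W n}) (act V a x) =
  act W a ((GRing.null_fun _ : {linear V m -> W m}) x).
Proof. by rewrite /= linear0. Qed.

Definition zero_hom V W : hom V W := MkHom (@zero_hom_nat V W).

Definition pair_fun U V W (f : hom U V) (g : hom U W) n (x : U n) : dsum V W n :=
  (f n x, g n x).

Lemma pair_fun_linear U V W (f : hom U V) (g : hom U W) n :
  linear (@pair_fun U V W f g n).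
Proof. by move=> c x y; rewrite /pair_fun !linearP. Qed.

Lemma pair_hom_nat U V W (f : hom U V) (g : hom U W) m n (a : incr m n) x :
  linear_of (@pair_fun_linear U V W f g n) (act U a x) =
  act (dsum V W) a (linear_of (@pair_fun_linear U V W f g m) x).
Proof. by rewrite /= /pair_fun !hom_nat. Qed.

Definition pair_hom U V W (f : hom U V) (g : hom U W) : hom U (dsum V W) :=
  MkHom (@pair_hom_nat U V W f g).

Lemma pair_homE U V W (f : hom U V) (g : hom U W) n x :
  pair_hom f g n x = (f n x, g n x).
Proof. by []. Qed.

Definition fst_hom V W : hom (dsum V W) V :=
  @MkHom k (dsum V W) V (fun n => fst : {linear (V n * W n)%type -> V n})
    (fun m n a x => erefl).
Definition snd_hom V W : hom (dsum V W) W :=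
  @MkHom k (dsum V W) W (fun n => snd : {linear (V n * W n)%type -> W n})
    (fun m n a x => erefl).

Definition copair_fun U V W (f : hom V U) (g : hom W U) n (x : dsum V W n) : U n :=
  f n x.1 + g n x.2.

Lemma copair_fun_linear U V W (f : hom V U) (g : hom W U) n :
  linear (@copair_fun U V W f g n).
Proof.
by move=> c x y; rewrite /copair_fun !linearP /= scalerDr addrACA.
Qed.

Lemma copair_hom_nat U V W (f : hom V U) (g : hom W U) m n (a : incr m n) x :
  linear_of (@copair_fun_linear U V W f g n) (act (dsum V W) a x) =
  act U a (linear_of (@copair_fun_linear U V W f g m) x).
Proof. by rewrite /= /copair_fun linearD !hom_nat. Qed.

Definition copair_hom U V W (f : hom V U) (g : hom W U) : hom (dsum V W) U :=
  MkHom (@copair_hom_nat U V W f g).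

Lemma zero_homE V W n (x : V n) : zero_hom V W n x = 0.
Proof. by []. Qed.

End HomOps.

(** * Increasing maps and principal modules *)

Section Increasing.
Implicit Types (d e m n p q r : nat).

Lemma incr_of m n (f : nat -> nat) :
  (forall i, (i < m)%N -> (f i < n)%N) ->
  (forall i j, (i < j)%N -> (j < m)%N -> (f i < f j)%N) ->
  {a : incr m n | forall i, a i = f i :> nat}.
Proof.
move=> fn fm; pose g := [ffun i : 'I_m => Ordinal (fn i (ltn_ord i))].
have gm : [forall i : 'I_m, forall j : 'I_m, (i < j)%N ==> (g i < g j)%N].
  by do 2!apply/forallP => ?; apply/implyP => ij; rewrite !ffunE /=; apply: fm.
by exists (exist _ g gm) => i; rewrite /incr_fun /= ffunE.
Qed.

Lemma incr_eqn m n (f g : incr m n) : (forall i, f i = g i :> nat) -> f = g.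
Proof. by move=> fg; apply: incr_eqP => i; apply/val_inj/fg. Qed.

Lemma incr_le m n (f : incr m n) (i j : 'I_m) : (i <= j)%N -> (f i <= f j)%N.
Proof.
by rewrite leq_eqVlt => /orP[/eqP/val_inj->//|/(incrP f)/ltnW].
Qed.

Lemma incr_lt m n (f : incr m n) (i j : 'I_m) : (f i < f j)%N = (i < j)%N.
Proof.
by apply/idP/idP => [|/incrP//]; rewrite !ltnNge; apply: contra => /incr_le.
Qed.

Lemma incr_inj m n (f : incr m n) : injective f.
Proof.
move=> i j fij; apply/val_inj; have := incr_lt f i j; have := incr_lt f j i.
by rewrite fij ltnn /=; lia.
Qed.

Lemma incr_leq m n (f : incr m n) : (m <= n)%N.
Proof. by have := leq_card f (@incr_inj m n f); rewrite !card_ord. Qed.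

Lemma incr_geid m n (f : incr m n) (i : 'I_m) : (i <= f i)%N.
Proof.
case: i => i; elim: i => // i IH im.
have im' := ltnW im; apply: leq_ltn_trans (IH im') _.
by rewrite incr_lt /=.
Qed.

Lemma incr_endo n (f : incr n n) : f = incr_id n.
Proof.
apply: incr_eqn => i; rewrite incr_idE; apply/eqP; rewrite eqn_leq incr_geid.
rewrite andbT.
suff H j (jn : (j < n)%N) : (f (Ordinal jn) + (n - j.+1) < n)%N.
  have := H i (ltn_ord i); have -> : Ordinal (ltn_ord i) = i by apply/val_inj.
  have := ltn_ord i; lia.
move eqt: (n - j.+1)%N => t.
elim: t j jn eqt => [|t IH] j jn eqt; first by rewrite addn0.
have jn' : (j.+1 < n)%N by lia.
have := IH j.+1 jn'; have /= := @incrP _ _ f (Ordinal jn) (Ordinal jn') (ltnSn j).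
lia.
Qed.

Lemma incr_comp_inj m n p (a : incr n p) (f g : incr m n) :
  incr_comp a f = incr_comp a g -> f = g.
Proof.
move=> afg; apply: incr_eqP => i; apply: (@incr_inj _ _ a).
by rewrite -!incr_compE afg.
Qed.

Lemma incr_comp_eq m n p (a : incr n p) (f g : incr m n) :
  (incr_comp a f == incr_comp a g) = (f == g).
Proof. by apply/eqP/eqP => [/incr_comp_inj|->]. Qed.

Lemma incr_compf1 m n (f : incr m n) : incr_comp f (incr_id m) = f.
Proof. by apply: incr_eqP => i; rewrite incr_compE incr_idE. Qed.

Lemma incr_widen m n : (m <= n)%N -> {a : incr m n | forall i, a i = i :> nat}.
Proof. by move=> mn; apply: (@incr_of m n id) => // i im; apply: leq_trans mn. Qed.

(** Each point of [g] has to be displaced by [f i - g i]; displacing every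
    other point as far as the last point of [g] before it gives an increasing
    map as soon as these displacements grow with [i]. *)
Lemma incr_lift d m n (g : incr d m) (f : incr d n) :
  (m <= n)%N -> (forall i, g i <= f i)%N ->
  (forall i j : 'I_d, (i <= j)%N -> (f i - g i <= f j - g j)%N) ->
  (forall i, f i - g i <= n - m)%N ->
  exists a : incr m n, incr_comp a g = f.
Proof.
move=> mn gf dm dn.
pose D y := (\max_(i < d | (g i <= y)%N) (f i - g i))%N.
have Dmn y : (D y <= n - m)%N by apply/bigmax_leqP.
have Dmon y z : (y <= z)%N -> (D y <= D z)%N.
  move=> yz; apply/bigmax_leqP => i iy;
  apply: (@leq_bigmax_cond _ (fun i => g i <= z)%N (fun i => f i - g i)%N).
  exact: leq_trans yz.
have [y ym|y z yz _|a aE] := @incr_of m n (fun y => y + D y)%N.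
- by have := Dmn y; lia.
- by have := Dmon y z (ltnW yz); lia.
exists a; apply: incr_eqn => i; rewrite incr_compE aE.
suff -> : D (g i) = (f i - g i)%N by have := gf i; lia.
apply/eqP; rewrite eqn_leq; apply/andP; split.
  apply/bigmax_leqP => j gji; apply: dm.
  by rewrite leqNgt -(incr_lt g) -leqNgt.
exact: (@leq_bigmax_cond _ (fun j => g j <= g i)%N (fun i => f i - g i)%N).
Qed.

(** Both [a] and [b] can be continued to one and the same map, as soon as the
    points of the latter are spread far enough. *)
Lemma incr_amalgam n p q (a : incr n p) (b : incr n q) :
  exists r (c : incr p r) (d : incr q r), incr_comp c a = incr_comp d b.
Proof.
pose L := (p + q).+1; pose r := (L * n.+2)%N.
have [i im|i j ij _|s sE] := @incr_of n r (fun i => L * i.+1)%N.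
- by rewrite /r ltn_mul2l /=; lia.
- by rewrite ltn_mul2l /=; lia.
have spread m (c : incr n m) : (m < L)%N -> exists c', incr_comp c' c = s.
  move=> mL; apply: incr_lift.
  - by rewrite /r; nia.
  - by move=> i; rewrite sE; have := ltn_ord (c i); nia.
  - move=> i j; rewrite leq_eqVlt => /orP[/eqP/val_inj->//|ij]; rewrite !sE.
    by have := ltn_ord (c i); have := ltn_ord (c j); nia.
  - by move=> i; rewrite sE /r; have := ltn_ord (c i); have := ltn_ord i; nia.
have [|c cE] := spread p a; first by rewrite /L; lia.
have [|d dE] := spread q b; first by rewrite /L; lia.
by exists r, c, d; rewrite cE dE.
Qed.

Lemma coface_def m (i : 'I_m.+1) :
  {a : incr m m.+1 | forall t, a t = bump i t :> nat}.
Proof.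
apply: incr_of => [t tm|t u tu um]; first by rewrite /bump; case: leqP; lia.
by rewrite /bump; do 2!case: leqP; lia.
Qed.

Definition coface m (i : 'I_m.+1) : incr m m.+1 := sval (coface_def i).

Lemma cofaceE m (i : 'I_m.+1) t : coface i t = bump i t :> nat.
Proof. exact: svalP (coface_def i) t. Qed.

Lemma incr_factor d m n (a : incr m n) (f : incr d n) :
  (forall i, exists j, a j = f i) -> exists g : incr d m, incr_comp a g = f.
Proof.
move=> /choice[s sE].
have [i id|i j ij jd|g gE] := @incr_of d m (fun t => if insub t is Some i then s i : nat else 0%N).
- by rewrite -[i]/(nat_of_ord (Ordinal id)) valK.
- rewrite -[i]/(nat_of_ord (Ordinal (ltn_trans ij jd))) -[j]/(nat_of_ord (Ordinal jd)) !valK.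
  by rewrite -(incr_lt a) !sE incr_lt.
exists g; apply: incr_eqP => i; rewrite incr_compE -sE; congr (a _).
by apply/val_inj; rewrite [LHS]gE valK.
Qed.

Lemma coface_factor n m (i : 'I_m.+1) (q : incr n m.+1) :
  (forall t, q t != i) -> exists p : incr n m, incr_comp (coface i) p = q.
Proof.
move=> qi; apply: incr_factor => t; case: (unliftP i (q t)) (qi t) => [j ->|->].
  by exists j; apply/val_inj; rewrite [LHS]cofaceE.
by rewrite eqxx.
Qed.

Lemma incr_misses n m (q : incr n m) : (n < m)%N -> exists i, forall t, q t != i.
Proof.
move=> nm; apply/not_existsP => /= H.
have surj i : i \in codom q.
  have /existsNP[t /negP] := H i; rewrite negbK => /eqP <-; exact: codom_f.
have : (#|'I_m| <= #|'I_n|)%N.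
  rewrite -(card_codom (@incr_inj _ _ q)); apply: subset_leq_card.
  exact/subsetP.
by rewrite !card_ord leqNgt nm.
Qed.

End Increasing.

Section Closure.
Variables (k : fieldType) (V : Cmod k).
Implicit Types P Q : forall n, V n -> Prop.

(** The elements that are torsion modulo [P]; they form a submodule because of
    amalgamation. *)
Definition closure P n (x : V n) : Prop :=
  exists p (a : incr n p), P p (act V a x).

Definition closed P := forall n (x : V n), closure P x -> P n x.

Definition torsion_free := forall m n (a : incr m n) (x : V m),
  act V a x = 0 -> x = 0.

Lemma closure_sub P n (x : V n) : P n x -> closure P x.
Proof. by move=> Px; exists n, (incr_id n); rewrite act_id. Qed.

Lemma closure_act P n p (a : incr n p) (x : V n) : closure P (act V a x) -> closure P x.
Proof. by move=> [q [b]]; rewrite -act_comp; exists q, (incr_comp b a). Qed.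

Lemma closure_subm P : is_subm P -> is_subm (closure P).
Proof.
move=> sP; split=> [n|n c x y [p [a Pax]] [q [b Pby]]|m n f x [p [a Pax]]].
- by apply: closure_sub; apply: subm0.
- have [r [a' [b' ab]]] := incr_amalgam a b.
  exists r, (incr_comp a' a); rewrite linearP; apply: subm_lin => //.
    by rewrite act_comp; apply: subm_act.
  by rewrite ab act_comp; apply: subm_act.
- have [r [a' [b' ab]]] := incr_amalgam a f.
  by exists r, b'; rewrite -act_comp -ab act_comp; apply: subm_act.
Qed.

Lemma closure_closed P : closed (closure P).
Proof. by move=> n x [p [a /closure_act]]. Qed.

End Closure.

Arguments torsion_free {k} V.

Section PrincipalModules.
Variable k : fieldType.
Implicit Types (V W : Cmod k) (d e m n : nat).

Definition delta d n (f : incr d n) : principal k d n := [ffun g => (g == f)%:R].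

Lemma delta_act d m n (a : incr m n) (f : incr d m) :
  act (principal k d) a (delta f) = delta (incr_comp a f).
Proof.
apply/ffunP => g; rewrite {1}/act /= !ffunE.
under eq_bigr do rewrite ffunE.
rewrite big_mkcond (bigD1 f) //= eqxx big1 ?addr0; last first.
  by move=> h /negPf->; case: ifP.
by rewrite eq_sym; case: eqP.
Qed.

Lemma delta_sumE d e n n' (x : principal k d n) (h : incr d n -> incr e n') g :
  (\sum_f (x f : k) *: delta (h f)) g = \sum_(f | h f == g) x f.
Proof.
rewrite sum_ffunE [RHS]big_mkcond; apply: eq_bigr => f _.
by rewrite !ffunE eq_sym; case: eqP => _; rewrite ?(scaler0, scale1r) //;
  rewrite /GRing.scale /= ?mulr1 ?mulr0.
Qed.

Lemma delta_sum d n (x : principal k d n) : x = \sum_f (x f : k) *: delta f.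
Proof.
apply/ffunP => g; rewrite (delta_sumE x id) /=.
by rewrite (big_pred1 g).
Qed.

Lemma act_delta_sum d m n (a : incr m n) (x : principal k d m) :
  act _ a x = \sum_f (x f : k) *: delta (incr_comp a f).
Proof.
rewrite {1}(delta_sum x) act_sum; apply: eq_bigr => f _.
by rewrite actZ delta_act.
Qed.

Lemma principal_torsion_free d : torsion_free (principal k d).
Proof.
move=> m n a x /ffunP ax; apply/ffunP => f; have := ax (incr_comp a f).
rewrite act_delta_sum delta_sumE ffunE (big_pred1 f) ?ffunE // => g /=.
exact: incr_comp_eq.
Qed.

(** The Yoneda morphism [M(d) -> V] of an element of [V_d]. *)
Section OfElt.
Variables (V : Cmod k) (d : nat) (v : V d).

Definition of_elt_fun n (c : principal k d n) : V n :=
  \sum_f (c f : k) *: act V f v.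

Lemma of_elt_linear n : linear (@of_elt_fun n).
Proof.
move=> c x y; rewrite /of_elt_fun scaler_sumr -big_split; apply: eq_bigr => f _.
by rewrite !ffunE /= scalerDl scalerA.
Qed.

Lemma of_elt_nat m n (a : incr m n) x :
  linear_of (@of_elt_linear n) (act (principal k d) a x) =
  act V a (linear_of (@of_elt_linear m) x).
Proof.
rewrite /= /of_elt_fun act_sum.
transitivity (\sum_(f : incr d m) (x f : k) *: act V (incr_comp a f) v).
  rewrite act_delta_sum [RHS](partition_big (incr_comp a) predT) //=.
  apply: eq_bigr => f _; rewrite delta_sumE scaler_suml.
  by apply: eq_bigr => g /eqP->.
by apply: eq_bigr => f _; rewrite actZ act_comp.
Qed.

Definition of_elt : hom (principal k d) V := MkHom of_elt_nat.

Lemma of_eltE n c : of_elt n c = \sum_f (c f : k) *: act V f v.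
Proof. by []. Qed.

Lemma of_elt_delta n (f : incr d n) : of_elt n (delta f) = act V f v.
Proof.
rewrite of_eltE (bigD1 f) //= ffunE eqxx scale1r big1 ?addr0 // => g /negPf gf.
by rewrite ffunE gf scale0r.
Qed.

Lemma of_elt_id : of_elt d (delta (incr_id d)) = v.
Proof. by rewrite of_elt_delta act_id. Qed.

End OfElt.

Lemma hom_principal V d (h : hom (principal k d) V) n c :
  h n c = of_elt (h d (delta (incr_id d))) n c.
Proof.
rewrite of_eltE {1}(delta_sum c) hom_sum; apply: eq_bigr => f _.
by rewrite homZ -hom_nat delta_act incr_compf1.
Qed.

(** Precomposition with [q], as a Yoneda morphism. *)
Definition rcomp e d (q : incr e d) : hom (principal k d) (principal k e) :=
  of_elt (delta q).

Lemma rcompE e d (q : incr e d) n (x : principal k d n) :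
  rcomp q n x = \sum_f (x f : k) *: delta (incr_comp f q).
Proof. by rewrite of_eltE; apply: eq_bigr => f _; rewrite delta_act. Qed.

Lemma rcomp_coef e d (q : incr e d) n (x : principal k d n) g :
  rcomp q n x g = \sum_(f | incr_comp f q == g) x f.
Proof. by rewrite rcompE (delta_sumE x (fun f => incr_comp f q)). Qed.

Lemma rcomp_delta e d (q : incr e d) n (f : incr d n) :
  rcomp q n (delta f) = delta (incr_comp f q).
Proof. by rewrite of_elt_delta delta_act. Qed.

Lemma rcomp_comp c e d (r : incr c e) (q : incr e d) n (x : principal k d n) :
  rcomp r n (rcomp q n x) = rcomp (incr_comp q r) n x.
Proof.
rewrite (rcompE q) hom_sum rcompE; apply: eq_bigr => f _.
by rewrite homZ rcomp_delta incr_compA.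
Qed.

Lemma rcomp1 d n (x : principal k d n) : rcomp (incr_id d) n x = x.
Proof.
rewrite rcompE [RHS]delta_sum; apply: eq_bigr => f _; by rewrite incr_compf1.
Qed.

(** A chain all of whose terms are moved by a rule that depends only on their
    restrictions along [q] vanishes as soon as its restriction does. *)
Lemma push_zero e d (q : incr e d) n (x : principal k d n) e' n'
    (h : incr d n -> incr e' n') :
  rcomp q n x = 0 ->
  (forall f f', incr_comp f q = incr_comp f' q -> h f = h f') ->
  \sum_f (x f : k) *: delta (h f) = 0.
Proof.
move=> xq hq; rewrite (partition_big (fun f => incr_comp f q) predT) //= big1 // => u _.
have [[f0 /eqP f0u]|nof] := pselect (exists f, incr_comp f q == u); last first.
  by rewrite big1 // => f fu; case: nof; exists f.
rewrite (eq_bigr (fun f => (x f : k) *: delta (h f0))); last first.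
  by move=> f /eqP fu; rewrite (hq f f0) ?f0u.
by rewrite -scaler_suml -rcomp_coef xq ffunE scale0r.
Qed.

End PrincipalModules.

(** * Noetherianity *)

Lemma mem_In (T : eqType) (x : T) s : x \in s -> List.In x s.
Proof. by elim: s => //= y s IH; rewrite inE => /orP[/eqP->|/IH]; [left | right]. Qed.

(** By induction on the number of functions: a finite set that is good for all
    functions but the first one misses only elements where the first function
    takes one of finitely many values. *)
Lemma dickson (T : Type) (cs : seq (T -> nat)) (L : T -> Prop) :
  exists B : seq T, (forall u, List.In u B -> L u) /\
    forall t, L t -> exists2 u, List.In u B &
      forall c, List.In c cs -> (c u <= c t)%N.
Proof.
elim: cs L => [|c cs IH] L.
  have [[t Lt]|nL] := pselect (exists t, L t).
    exists [:: t]; split=> [u [<-|//] //|u Lu]; exists t => //; by left.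
  by exists [::]; split=> // t Lt; case: nL; exists t.
have [B0 [LB0 domB0]] := IH L.
have [A cA] : exists A, forall u, List.In u B0 -> (c u <= A)%N.
  elim: (B0) => [|u B [A cA]]; first by exists 0%N.
  exists (maxn (c u) A) => v [<-|/cA]; rewrite leq_max ?leqnn //.
  by move->; rewrite orbT.
suff [B [LB domB]] : exists B : seq T, (forall u, List.In u B -> L u) /\
    forall t, L t -> (c t < A)%N -> exists2 u, List.In u B &
      forall c', List.In c' (c :: cs) -> (c' u <= c' t)%N.
  exists (B0 ++ B); split=> [u /(List.in_app_or B0 B) [/LB0|/LB]//|t Lt].
  have [cAt|At] := ltnP (c t) A.
    by have [u uB cu] := domB t Lt cAt; exists u => //; apply: List.in_or_app; right.
  have [u uB cu] := domB0 t Lt.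
  exists u => [|c' [<-|/cu//]]; first by apply: List.in_or_app; left.
  exact: leq_trans (cA u uB) At.
elim: A {cA} => [|A [B [LB domB]]]; first by exists [::].
have [B' [LB' domB']] := IH (fun t => L t /\ c t = A).
exists (B ++ B'); split=> [u /(List.in_app_or B B') [/LB|/LB'[]]//|t Lt].
rewrite ltnS leq_eqVlt => /orP[/eqP ctA|ctA].
  have [u uB cu] := domB' t (conj Lt ctA).
  exists u => [|c' [<-|/cu//]]; first by apply: List.in_or_app; right.
  by have [_ ->] := LB' u uB; rewrite ctA.
by have [u uB cu] := domB t Lt ctA; exists u => //; apply: List.in_or_app; left.
Qed.

Section Generation.
Variable k : fieldType.
Implicit Types V W : Cmod k.

Definition elt V n (x : V n) : {n & V n} := existT (fun n => V n : Type) n x.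

Definition generates V (l : seq {n & V n}) (P : forall n, V n -> Prop) : Prop :=
  forall Q, is_subm Q -> (forall g, List.In g l -> Q _ (tagged g)) ->
    forall n x, P n x -> Q n x.

Definition noetherian V : Prop := forall P : forall n, V n -> Prop, is_subm P ->
  exists l, (forall g, List.In g l -> P _ (tagged g)) /\ generates l P.

Lemma subm_preim V W (f : hom V W) (Q : forall n, W n -> Prop) :
  is_subm Q -> is_subm (fun n x => Q n (f n x)).
Proof.
move=> sQ; split=> [n|n c x y Qx Qy|m n a x Qx].
- by rewrite hom0; apply: subm0.
- by rewrite linearP; apply: subm_lin.
- by rewrite hom_nat; apply: subm_act.
Qed.

Lemma subm_im V W (f : hom V W) (P : forall n, V n -> Prop) :
  is_subm P -> is_subm (fun n y => exists2 x, P n x & f n x = y).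
Proof.
move=> sP; split=> [n|n c _ _ [x Px <-] [y Py <-]|m n a _ [x Px <-]].
- by exists 0; rewrite ?hom0 //; apply: subm0.
- by exists (c *: x + y); rewrite ?linearP //; apply: subm_lin.
- by exists (act V a x); rewrite ?hom_nat //; apply: subm_act.
Qed.

Lemma subm_all V : is_subm (fun n (_ : V n) => True).
Proof. by []. Qed.

Lemma subm_cap V (P Q : forall n, V n -> Prop) :
  is_subm P -> is_subm Q -> is_subm (fun n x => P n x /\ Q n x).
Proof.
move=> sP sQ; split=> [n|n c x y [Px Qx] [Py Qy]|m n a x [Px Qx]].
- by split; apply: subm0.
- by split; apply: subm_lin.
- by split; apply: subm_act.
Qed.

Lemma subm_ker V W (f : hom V W) : is_subm (fun n x => f n x = 0).
Proof.
split=> [n|n c x y fx fy|m n a x fx]; first exact: hom0.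
- by rewrite linearP fx fy /= scaler0 addr0.
- by rewrite hom_nat fx act0.
Qed.

Lemma generates_map V W (f : hom V W) l (P : forall n, V n -> Prop) :
  generates l P ->
  generates [seq elt (f _ (tagged g)) | g <- l]
    (fun n y => exists2 x, P n x & f n x = y).
Proof.
move=> gl Q sQ Ql n y [x Px <-].
apply: (gl _ (subm_preim f sQ) _ n x Px) => g gl'.
exact: (Ql _ (List.in_map (fun g => elt (f _ (tagged g))) _ _ gl')).
Qed.

Lemma noetherian_im V W (f : hom V W) :
  (forall n y, exists x, f n x = y) -> noetherian V -> noetherian W.
Proof.
move=> fsurj nV P sP.
have [l [Pl gl]] := nV _ (subm_preim f sP).
exists [seq elt (f _ (tagged g)) | g <- l]; split=> [g|].
  by move=> /List.in_map_iff[h [<- /Pl]].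
move=> Q sQ Ql n y Py; have [x fx] := fsurj n y.
by apply: (generates_map gl sQ Ql); exists x; rewrite ?fx.
Qed.

Lemma noetherian_dsum V W : noetherian V -> noetherian W -> noetherian (dsum V W).
Proof.
move=> nV nW P sP.
have [l1 [Pl1 gl1]] := nV _ (subm_preim (pair_hom (hom_id V) (zero_hom V W)) sP).
have [l2 [Pl2 gl2]] := nW _ (subm_im (snd_hom V W) sP).
have [l3 [Pl3 l23]] : exists l3 : seq {n & dsum V W n},
    (forall g, List.In g l3 -> P _ (tagged g)) /\
    forall h, List.In h l2 -> exists2 g, List.In g l3 &
      h = elt (snd_hom V W _ (tagged g)).
  elim: l2 Pl2 {gl2} => [|[n y] l2 IH] Pl2; first by exists [::].
  have [l3 [Pl3 l23]] := IH (fun g gl => Pl2 g (or_intror gl)).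
  have [x Px xy] := Pl2 _ (or_introl erefl).
  exists (elt x :: l3); split=> [g [<-//|/Pl3//]|h [<-|/l23[g gl3 ->]]].
    by exists (elt x); [left | rewrite /= xy].
  by exists g => //; right.
pose i1 := pair_hom (hom_id V) (zero_hom V W).
exists ([seq elt (i1 _ (tagged g)) | g <- l1] ++ l3); split=> [g|].
  by move=> /(@List.in_app_or _ _ l3) [/List.in_map_iff[h [<- /Pl1]]|/Pl3].
move=> Q sQ Ql n x Px.
have [x' [Px' Qx'] xx'] : exists2 x', (P n x' /\ Q n x') & x'.2 = x.2.
  apply: (gl2 _ (subm_im (snd_hom V W) (subm_cap sP sQ))); last by exists x.
  move=> h /l23[g gl3 ->]; exists (tagged g) => //; split; first exact: Pl3.
  by apply: Ql; apply: List.in_or_app; right.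
rewrite -[x](subrK x'); apply: submD => //.
have -> : x - x' = i1 n (x.1 - x'.1).
  by rewrite /i1 pair_homE zero_homE; congr pair; rewrite /= xx' subrr.
apply: (gl1 _ (subm_preim i1 sQ)) => [g gl|].
  apply: (Ql (elt (i1 _ (tagged g)))); apply: List.in_or_app; left.
  exact: (List.in_map (fun g => elt (i1 _ (tagged g)))).
have <- : x - x' = i1 n (x.1 - x'.1).
  by rewrite /i1 pair_homE zero_homE; congr pair; rewrite /= xx' subrr.
exact: submB.
Qed.

Section LeadingTerm.
Variable d : nat.

Definition key n (f : incr d n) : d.-tuplelexi 'I_n := [tuple f i | i < d].

Lemma key_inj n : injective (@key n).
Proof.
move=> f g fg; apply: incr_eqP => i.
by have := congr1 (fun t => tnth t i) fg; rewrite !tnth_mktuple.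
Qed.

Lemma key_lt n (f g : incr d n) : reflect
  (exists2 i : 'I_d, forall j : 'I_d, (j < i)%N -> f j = g j & (f i < g i)%N)
  (key f < key g)%O.
Proof.
apply: (iffP ltxi_tuplePlt) => -[i fg fgi]; exists i => [j ji|].
- by have := fg j ji; rewrite !tnth_mktuple.
- by move: fgi; rewrite !tnth_mktuple.
- by rewrite !tnth_mktuple; apply: fg.
- by rewrite !tnth_mktuple.
Qed.

Lemma key_le_comp n p (a : incr n p) (f g : incr d n) :
  (key f <= key g)%O -> (key (incr_comp a f) <= key (incr_comp a g))%O.
Proof.
rewrite le_eqVlt => /orP[/eqP/key_inj->//|/key_lt[i fg fgi]].
apply/ltW/key_lt; exists i => [j ji|].
  by rewrite !incr_compE fg.
by rewrite !incr_compE incr_lt.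
Qed.

Definition leads n (x : principal k d n) (f : incr d n) : Prop :=
  x f != 0 /\ forall g, x g != 0 -> (key g <= key f)%O.

Lemma leads_exists n (x : principal k d n) : x != 0 -> exists f, leads x f.
Proof.
move=> x0; have [f xf] : exists f, x f != 0.
  apply/not_existsP => H; move/eqP: x0; apply; apply/ffunP => f.
  by rewrite ffunE; apply/eqP; move: (H f) => /negP; rewrite negbK.
case: (@Order.TotalTheory.arg_maxP _ _ _ f (fun f => x f != 0) (@key n) xf) => g xg gmax.
by exists g; split.
Qed.

Definition pt (f : {n & incr d n}) (i : 'I_d) : nat := tagged f i.

(** Coordinates for which coordinatewise comparison of two injections forces
    the larger one to factor through the smaller one. *)
Definition gaps : seq ({n & incr d n} -> nat) :=
  tag :: [seq pt^~ i | i <- enum 'I_d] ++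
  [seq (fun f => tag f - pt f i)%N | i <- enum 'I_d] ++
  [seq (fun f => pt f ij.2 - pt f ij.1)%N | ij <- enum {: 'I_d * 'I_d}].

Lemma gaps_lift m n (g : incr d m) (f : incr d n) :
  (forall c, List.In c gaps -> (c (existT _ m g) <= c (existT _ n f))%N) ->
  exists a : incr m n, incr_comp a g = f.
Proof.
move=> gf.
have mn : (m <= n)%N by apply: (gf tag); left.
have c1 i : (g i <= f i)%N.
  apply: (gf (pt^~ i)); right; apply: List.in_or_app; left.
  apply: (List.in_map (fun i f => pt f i)).
  by apply: mem_In; rewrite mem_enum.
have c2 i : (m - g i <= n - f i)%N.
  apply: (gf (fun f => tag f - pt f i)%N); right; apply: List.in_or_app; right.
  apply: List.in_or_app; left.
  apply: (List.in_map (fun i f => tag f - pt f i)%N).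
  by apply: mem_In; rewrite mem_enum.
have c3 i j : (g j - g i <= f j - f i)%N.
  apply: (gf (fun f => pt f (i, j).2 - pt f (i, j).1)%N).
  right; do 2![apply: List.in_or_app; right].
  apply: (List.in_map (fun ij f => pt f ij.2 - pt f ij.1)%N).
  by apply: mem_In; rewrite mem_enum.
apply: incr_lift => // [i j ij|i].
  have := c1 i; have := c1 j; have := c3 i j.
  by have := incr_le g ij; have := incr_le f ij; lia.
by have := c1 i; have := c2 i; have := ltn_ord (g i); have := ltn_ord (f i); lia.
Qed.

(** Groebner bases: by Dickson's lemma finitely many leading terms divide all
    leading terms of [P], and the corresponding elements generate [P]. *)
Lemma noetherian_principal : noetherian (principal k d).
Proof.
move=> P sP.
pose L (t : {n & incr d n}) := exists x, P (tag t) x /\ leads x (tagged t).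
pose y t : principal k d (tag t) := if pselect (L t) is left Lf then
  projT1 (cid Lf) else 0.
have yP t : L t -> P _ (y t) /\ leads (y t) (tagged t).
  by move=> Lt; rewrite /y; case: pselect => //= Lt'; apply: projT2 (cid Lt').
have [B [LB domB]] := dickson gaps L.
exists [seq elt (y t) | t <- B]; split=> [g /List.in_map_iff[t [<- /LB/yP[]//]]|].
move=> Q sQ QB n.
(* Subtracting multiples of the generators lowers the rank of the support. *)
pose rank (f : incr d n) := #|[set g | (key g < key f)%O]|.
suff H M (x : principal k d n) : P n x ->
    (forall f, x f != 0 -> (rank f < M)%N) -> Q n x.
  move=> x Px; apply: (H #|[set: incr d n]|.+1) => // f _.
  by rewrite ltnS subset_leq_card //; apply: subsetT.
elim: M x => [|M IH] x Px xM; have [->|x0] := eqVneq x 0; do ?exact: subm0.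
  by have [f [/xM]] := leads_exists x0.
have [f [xf lf]] := leads_exists x0.
have [[m g] gB gf] := domB (existT _ n f) (ex_intro _ x (conj Px (conj xf lf))).
have [a ag] := gaps_lift gf.
have [Py [yg lg]] := yP _ (LB _ gB).
have Qy : Q _ (y (existT _ m g)) := QB _ (List.in_map (fun t => elt (y t)) _ _ gB).
move: (y _) Py yg lg Qy => {gf} u Pu ug lg Qu.
rewrite /= in ug lg.
have actE h : (act _ a u) h = \sum_(h0 | incr_comp a h0 == h) u h0.
  by rewrite act_delta_sum delta_sumE.
pose c : k := (x f : k) / u g.
rewrite -[x](subrK (c *: act _ a u)); apply: submD => //; last first.
  by apply: submZ => //; apply: subm_act.
apply: IH => [|h]; first by apply: submB => //; apply: submZ => //; apply: subm_act.
have -> : (x - c *: act _ a u) h = (x h : k) - c * (act _ a u h : k).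
  by rewrite !ffunE.
have [->|hf] := eqVneq h f.
  by rewrite actE (big_pred1 g) /c ?divfK ?subrr ?eqxx // => h0; rewrite -{1}ag incr_comp_eq.
move=> zh; have hlef : (key h <= key f)%O.
  have [xh|/lf//] := eqVneq (x h) 0.
  have [auh|auh] := eqVneq (act _ a u h) 0.
    by move: zh; rewrite xh auh mulr0 subrr eqxx.
  have [h0 /eqP h0h uh0] : exists2 h0, incr_comp a h0 == h & u h0 != 0.
    apply/not_exists2P => H; move/eqP: auh; apply; rewrite actE big1 // => h0 h0h.
    by have [//|/negP] := H h0; rewrite negbK => /eqP.
  by rewrite -h0h -ag; apply: key_le_comp; apply: lg.
have {}hlef : (key h < key f)%O.
  by rewrite lt_neqAle hlef andbT; apply: contra hf => /eqP/key_inj->.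
have := xM f xf; rewrite ltnS; apply: leq_trans.
apply: proper_card; apply/properP; split.
  by apply/subsetP => h1; rewrite !inE => /lt_trans; apply.
by exists h; rewrite !inE ?ltxx.
Qed.

End LeadingTerm.

Lemma noetherian_principal_sum s : noetherian (principal_sum k s).
Proof.
elim: s => [|d s IH] /=; last exact: noetherian_dsum (@noetherian_principal d) IH.
move=> P sP; exists [::]; split=> // Q sQ _ n x _.
by rewrite (thinmx0 x); apply: (subm0 sQ n).
Qed.

Lemma fg_noetherian V : finitely_generated V -> noetherian V.
Proof.
move=> [s [f fsurj]]; exact: noetherian_im fsurj (@noetherian_principal_sum s).
Qed.

Fixpoint gens_hom V (l : seq {n & V n}) : hom (principal_sum k (map tag l)) V :=
  if l is g :: l' then copair_hom (of_elt (tagged g)) (gens_hom l')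
  else zero_hom _ V.

Lemma generates_fg V (l : seq {n & V n}) :
  generates l (fun _ _ => True) -> finitely_generated V.
Proof.
move=> gl; exists (map tag l), (gens_hom l) => n y.
have [] // := gl _ (subm_im (gens_hom l) (@subm_all _)) _ n y; last by move=> x; exists x.
move=> g {gl}; elim: l => //= h l IH [->|/IH[x _ <-]].
  exists (delta k (incr_id _), 0) => //.
  by rewrite -[LHS]/(of_elt _ _ _ + gens_hom l _ _) hom0 addr0 of_elt_id.
by exists (0, x) => //; rewrite -[LHS]/(of_elt _ _ _ + gens_hom l _ _) hom0 add0r.
Qed.

Lemma noetherian_fg V : noetherian V -> finitely_generated V.
Proof. by move=> /(_ _ (@subm_all V))[l [_ /generates_fg]]. Qed.

Lemma noetherian_sub V (P : forall n, V n -> Prop) (sP : is_subm P) :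
  noetherian V -> noetherian (sub_cmod sP).
Proof.
move=> nV Q sQ; have [l [Ql gl]] := nV _ (subm_im (sub_incl sP) sQ).
have [l' [Ql' ll']] : exists l' : seq {n & sub_cmod sP n},
    (forall g, List.In g l' -> Q _ (tagged g)) /\
    l = [seq elt (sub_incl sP _ (tagged g)) | g <- l'].
  elim: l Ql {gl} => [|[n x] l IH] Ql; first by exists [::].
  have [l' [Ql' ->]] := IH (fun g gl => Ql g (or_intror gl)).
  have [y Qy yx] := Ql _ (or_introl erefl).
  exists (elt y :: l'); split=> [g [<-//|/Ql'//]|].
  by rewrite /= -/(elt x) -[x in LHS]yx.
exists l'; split=> // R sR Rl n x Qx.
have [||z Rz /sub_incl_inj <-//] := gl _ (subm_im (sub_incl sP) sR) _ n (sub_incl sP n x).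
  by move=> g; rewrite ll' => /List.in_map_iff[h [<- hl']]; exists (tagged h); rewrite //; apply: Rl.
by exists x.
Qed.

End Generation.

(** * Alternating cubes and the socle of a principal module *)

Section Ext.
Variables (m n : nat) (f : incr m n).

(** Past the end the value is [n], a point after all points of [f]. *)
Definition ext t : nat := if insub t is Some i then f i else n.

Lemma ext_ord (i : 'I_m) : ext i = f i.
Proof. by rewrite /ext valK. Qed.

Lemma ext_ge t : (m <= t)%N -> ext t = n.
Proof. by move=> mt; rewrite /ext insubF // ltnNge mt. Qed.

Lemma ext_lt t u : (t < m)%N -> (t < u)%N -> (ext t < ext u)%N.
Proof.
move=> tm tu; rewrite -[t]/(nat_of_ord (Ordinal tm)) ext_ord.
have [um|mu] := ltnP u m; last by rewrite ext_ge.
by rewrite -[u]/(nat_of_ord (Ordinal um)) ext_ord incrP.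
Qed.

Lemma ext_le t : (ext t <= n)%N.
Proof.
have [tm|/ext_ge->//] := ltnP t m.
by rewrite -[t]/(nat_of_ord (Ordinal tm)) ext_ord ltnW.
Qed.

Lemma ext_ltn t : (t < m)%N -> (ext t < n)%N.
Proof. by move=> tm; rewrite -[t]/(nat_of_ord (Ordinal tm)) ext_ord. Qed.
End Ext.

Lemma ext_coface m n (i : 'I_m.+1) (f g : incr m.+1 n) (t : nat) :
  incr_comp f (coface i) = incr_comp g (coface i) -> t != i :> nat -> ext f t = ext g t.
Proof.
move=> fg ti; have [tm|mt] := ltnP t m.+1; last by rewrite !ext_ge.
have [u tu] : exists u : 'I_m.+1, t = u by exists (Ordinal tm).
rewrite {}tu in ti *; rewrite !ext_ord; case: (unliftP i u) ti => [v ->|->] => [_|/eqP//].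
have -> : lift i v = coface i v by apply/val_inj; rewrite [RHS]cofaceE.
by rewrite -!incr_compE fg.
Qed.

Lemma omit_point d (i : 'I_d) : exists e (q : incr e d), [/\ (e < d)%N,
  forall t, q t != i & forall n (f g : incr d n) (t : nat),
    incr_comp f q = incr_comp g q -> t != i :> nat -> ext f t = ext g t].
Proof.
case: d i => [[]//|d] i; exists d, (coface i); split=> [//|t|n f g t]; last exact: ext_coface.
by apply/eqP => /(congr1 val) /= /eqP; rewrite cofaceE eq_sym (negPf (neq_bump _ _)).
Qed.

Lemma sum_single (U : nmodType) (I : finType) (j : I) (F : I -> U) :
  (forall i, i != j -> F i = 0) -> \sum_i F i = F j.
Proof. by move=> F0; rewrite (bigD1 j) //= big1 ?addr0. Qed.

Section AlternatingSums.
Variables (k : fieldType) (d : nat).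
Implicit Types T : {set 'I_d}.

(** The terms for [T] with and without [i] cancel. *)
Lemma alt_sum_zero (U : lmodType k) (i : 'I_d) (F : {set 'I_d} -> U) :
  (forall T, F (i |: T) = F (T :\ i)) ->
  \sum_(T : {set 'I_d}) (-1) ^+ #|T| *: F T = 0.
Proof.
move=> Fi; rewrite (bigID (fun T : {set 'I_d} => i \in T)) /=.
rewrite (reindex_onto (fun T : {set 'I_d} => i |: T) (fun T : {set 'I_d} => T :\ i)) /=; last first.
  by move=> T; apply: setD1K.
rewrite (eq_bigl (fun T : {set 'I_d} => i \notin T)) -?big_split /=; last first.
  move=> T; rewrite setU11 /=; apply/eqP/idP => [<-|iT]; first by rewrite !inE eqxx.
  exact: setU1K.
rewrite big1 // => T iT; rewrite cardsU1 iT exprS Fi mulN1r scaleNr.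
have -> : T :\ i = T by apply/setP => j; rewrite !inE; case: eqP => // ->; rewrite (negPf iT).
by rewrite addNr.
Qed.

Definition memT T (t : nat) : bool := if insub t is Some i then i \in T else false.

Lemma memT_ord T (i : 'I_d) : memT T i = (i \in T).
Proof. by rewrite /memT valK. Qed.

Lemma corner_def T : {a : incr d (2 * d) | forall i, a i = (2 * i + (i \in T))%N :> nat}.
Proof.
have [i id|i j ij jd|a aE] := @incr_of d (2 * d) (fun t => 2 * t + memT T t)%N.
- by case: memT; lia.
- by do 2!case: memT; lia.
by exists a => i; rewrite aE memT_ord.
Qed.

Definition corner T := sval (corner_def T).

Lemma cornerE T i : corner T i = (2 * i + (i \in T))%N :> nat.
Proof. exact: svalP (corner_def T) i. Qed.

(** The product of the differences [[2 i] - [2 i + 1]] for [i < d], expanded. *)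
Definition cube : principal k d (2 * d) :=
  \sum_(T : {set 'I_d}) (-1) ^+ #|T| *: delta k (corner T).

Lemma cube_neq0 : cube != 0.
Proof.
apply/eqP => /ffunP/(_ (corner set0)).
rewrite ffunE sum_ffunE (bigD1 set0) //= big1 => [|T T0].
  by rewrite !ffunE eqxx cards0 expr0 addr0 => /eqP; rewrite scale1r oner_eq0.
rewrite !ffunE; case: eqP => [c0T|_]; last by rewrite scaler0.
case/eqP: T0; apply/setP => i; rewrite inE.
have := congr1 (fun a : incr _ _ => nat_of_ord (a i)) c0T.
by rewrite !cornerE inE; case: (i \in T) => //; lia.
Qed.

Definition socle n (z : principal k d n) : Prop :=
  forall e (q : incr e d), (e < d)%N -> rcomp k q n z = 0.

Lemma socle_subm : is_subm socle.
Proof.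
split=> [n|n c x y sx sy|m n a x sx] e q ed; first by rewrite hom0.
- by rewrite linearP (sx e q ed) (sy e q ed) /= scaler0 addr0.
- by rewrite hom_nat (sx e q ed) act0.
Qed.

Lemma cube_socle : socle cube.
Proof.
move=> e q /(incr_misses q)[i iq]; rewrite hom_sum.
under eq_bigr do rewrite homZ rcomp_delta.
apply: (alt_sum_zero (i := i)) => T; congr delta; apply: incr_eqn => t.
by rewrite !incr_compE !cornerE !inE (negPf (iq t)).
Qed.

Lemma incr_support n (f g : incr d n) : f != g -> exists i, forall t, g t != f i.
Proof.
move=> fg; apply/not_existsP => H; case/eqP: fg.
have [i|a <-] := @incr_factor _ _ _ g f.
  by have /existsNP[t /negP] := H i; rewrite negbK => /eqP <-; exists t.
by rewrite (incr_endo a) incr_compf1.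
Qed.

(** Doubling the points of one injection [f] in the support of [y] and taking
    the alternating sum over the two choices for each point kills every other
    injection, as it misses one of the doubled points. *)
Lemma cube_from (P : forall n, principal k d n -> Prop) n (y : principal k d n) :
  is_subm P -> P n y -> y != 0 -> exists m (a : incr (2 * d) m), P m (act _ a cube).
Proof.
move=> sP Py y0; have [f yf] : exists f : incr d n, y f != 0.
  apply/not_existsP => H; move/eqP: y0; apply; apply/ffunP => f.
  by rewrite ffunE; apply/eqP; move: (H f) => /negP; rewrite negbK.
have dbl (T : {set 'I_d}) : {a : incr n (2 * n) | forall p,
    a p = (2 * p + [exists i in T, f i == p])%N :> nat}.
  have [i id|i j ij jd|a aE] := @incr_of n (2 * n)
    (fun t => 2 * t + [exists i in T, f i == t :> nat])%N.
  - by case: [exists _ in _, _]; lia.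
  - by do 2!case: [exists _ in _, _]; lia.
  by exists a => p; rewrite aE.
have [t td|t u tu ud|z zE] := @incr_of (2 * d) (2 * n)
    (fun t => 2 * ext f (t %/ 2) + t %% 2)%N.
- have : (ext f (t %/ 2) < n)%N by apply: ext_ltn; lia.
  by lia.
- have [e|ne] := eqVneq (t %/ 2)%N (u %/ 2)%N; first by rewrite e; lia.
  have : (ext f (t %/ 2) < ext f (u %/ 2))%N by apply: ext_lt; lia.
  by lia.
(* [dbl T] moves the points [f i] with [i \in T] to their second copy. *)
exists (2 * n)%N, z.
have -> : act _ z cube = (y f : k)^-1 *:
    \sum_(T : {set 'I_d}) (-1) ^+ #|T| *: act _ (sval (dbl T)) y.
  under [in RHS]eq_bigr do rewrite act_delta_sum scaler_sumr.
  rewrite exchange_big (sum_single (j := f)) => [|g gf].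
    rewrite /cube act_sum scaler_sumr; apply: eq_bigr => T _.
    rewrite actZ delta_act !scalerA [X in _ = X *: _]mulrAC mulVf // mul1r; congr (_ *: delta _ _).
    apply: incr_eqn => i; rewrite !incr_compE zE (svalP (dbl T)) cornerE.
    have -> : ((2 * i + (i \in T)) %/ 2 = i)%N by case: (i \in T); lia.
    have -> : ((2 * i + (i \in T)) %% 2 = (i \in T))%N by case: (i \in T); lia.
    rewrite ext_ord; congr (_ + nat_of_bool _)%N.
    apply/idP/existsP => [iT|[j /andP[jT /eqP/incr_inj<-//]]].
    by exists i; rewrite iT eqxx.
  (* Every [g] other than [f] misses some [f i]. *)
  have [i gi] := incr_support (f := f) (g := g) (introN eqP (fun e => elimN eqP gf (esym e))).
  under eq_bigr do rewrite scalerA mulrC -scalerA.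
  rewrite -scaler_sumr; apply/eqP; rewrite scaler_eq0; apply/orP; right; apply/eqP.
  apply: (alt_sum_zero (i := i)) => T; congr delta; apply: incr_eqn => t.
  rewrite !incr_compE !(svalP (dbl _)); congr (_ + nat_of_bool _)%N.
  apply/existsP/existsP => -[j /andP[jT /eqP fj]]; exists j; rewrite fj eqxx andbT.
    by move: jT; rewrite !inE; case: (eqVneq j i) fj => // -> e; case/eqP: (gi t).
  by move: jT; rewrite !inE => /andP[_ ->]; rewrite orbT.
apply: submZ => //; apply: subm_sum => // T _; apply: submZ => //; exact: subm_act.
Qed.

End AlternatingSums.

(** Take the sum over [f] of [x f] times the cube with points [2 f i + 1] and
    [2 f (i+1)]. The first vertices of the cubes add up to [x] with its points
    doubled. Any other vertex skips a point of [f], so that these vertices only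
    see a face of [x], and the faces of [x] vanish. *)
Lemma socle_expansion (k : fieldType) d m (x : principal k d m) : socle x ->
  exists p (a : incr m p) (b : incr d m -> incr (2 * d) p),
    act _ a x = \sum_f (x f : k) *: act _ (b f) (cube k d).
Proof.
move=> sx; pose p := (2 * m).+1; exists p.
have [t tm|t u tu um|a aE] := @incr_of m p (fun t => (2 * t).+1); do ?by rewrite /p; lia.
exists a.
have b (f : incr d m) : {b : incr (2 * d) p | forall t, b t =
    (if t %% 2 == 0 then (2 * ext f (t %/ 2)).+1 else 2 * ext f (t %/ 2).+1)%N :> nat}.
  have [t td|t u tu ud|b bE] := @incr_of (2 * d) p
    (fun t => if t %% 2 == 0 then (2 * ext f (t %/ 2)).+1 else 2 * ext f (t %/ 2).+1)%N.
  - have td2 : (t %/ 2 < d)%N by lia.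
    by have := ext_le f (t %/ 2).+1; have := ext_ltn f td2; rewrite /p; case: eqP; lia.
  - have ud2 : (u %/ 2 < d)%N by lia.
    have td2 : (t %/ 2 < d)%N by lia.
    have := ext_lt f td2 (ltnSn _); have := ext_lt f ud2 (ltnSn _).
    have [e|ne] := eqVneq (t %/ 2)%N (u %/ 2)%N; first by rewrite -e; do 2!case: eqP; lia.
    have : (ext f (t %/ 2).+1 <= ext f (u %/ 2))%N.
      have [->//|ne'] := eqVneq (t %/ 2).+1 (u %/ 2)%N.
      by apply/ltnW/ext_lt; lia.
    by do 2!case: eqP; lia.
  by exists b.
exists (fun f => sval (b f)).
under eq_bigr => f _.
  rewrite /cube act_sum scaler_sumr.
  under eq_bigr => T _ do rewrite actZ delta_act scalerA mulrC -scalerA.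
  over.
rewrite exchange_big (sum_single (j := set0)) => [|T /set0Pn[j jT]].
  rewrite act_delta_sum; apply: eq_bigr => f _; rewrite cards0 expr0 scale1r.
  congr (_ *: delta _ _); apply: incr_eqn => i; rewrite !incr_compE aE (svalP (b f)) cornerE inE.
  by rewrite addn0 modnMr mulKn // ext_ord.
rewrite -scaler_sumr; apply/eqP; rewrite scaler_eq0; apply/orP; right; apply/eqP.
(* The vertices indexed by [T] do not involve the value of [f] at [min T]. *)
have [i iT imin] : exists2 i, i \in T & forall t : 'I_d, t \in T -> (i <= t)%N.
  by case: (arg_minnP (fun i : 'I_d => i : nat) jT) => i iT imin; exists i.
have [e [q [ed _ ext_q]]] := omit_point i.
apply: (push_zero (sx _ q ed)) => f g fg; apply: incr_eqn => t.
rewrite !incr_compE !(svalP (b _)) cornerE.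
have -> : ((2 * t + (t \in T)) %/ 2 = t)%N by case: (t \in T); lia.
have -> : ((2 * t + (t \in T)) %% 2 = (t \in T))%N by case: (t \in T); lia.
case tT: (t \in T) => /=; rewrite (ext_q _ _ _ _ fg) //.
  by have := imin t tT; lia.
by apply/eqP => ti; move: iT; rewrite -(val_inj ti) tT.
Qed.

(** [P] contains an image of the cube, so its closure contains the cube, hence
    all images of the cube, and hence the socle. *)
Theorem socle_dense (k : fieldType) d (P : forall n, principal k d n -> Prop)
    n (y : principal k d n) m (x : principal k d m) :
  is_subm P -> P n y -> y != 0 -> socle x -> closure P x.
Proof.
move=> sP Py y0 /socle_expansion[p [a [b ax]]].
have sQ := closure_subm sP.
have [r [c Pc]] := cube_from sP Py y0.
have Qcube : closure P (cube k d) by exists r, c.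
apply: (@closure_act _ _ _ _ _ a); rewrite ax.
by apply: subm_sum => // f _; apply: submZ => //; apply: subm_act.
Qed.

(** * Injectivity of principal modules *)

Section Filling.
Variable k : fieldType.

(** The families that could be the faces of a chain of degree [m + 1]: the two
    ways to restrict to a common face agree. *)
Definition compatible m K (x : 'I_m.+1 -> principal k m K) : Prop :=
  forall i j n (p q : incr n m), incr_comp (coface i) p = incr_comp (coface j) q ->
    rcomp k p K (x i) = rcomp k q K (x j).

Lemma act_rcomp e d (q : incr e d) m n (a : incr m n) (x : principal k d m) :
  rcomp k q n (act _ a x) = act _ a (rcomp k q m x).
Proof. exact: hom_nat. Qed.

(** The old points are the odd ones; the point inserted at [j] lies just before
    the old point [f j], or after all points if [j = m]. *)
Lemma insert_def m K (j : 'I_m.+1) (f : incr m K) : {s : incr m.+1 (2 * K).+1 |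
  forall t, s t = (if t < j then (2 * ext f t).+1 else
    if t == j :> nat then 2 * ext f t else (2 * ext f t.-1).+1)%N :> nat}.
Proof.
have [t tm|t u tu um|s sE] := @incr_of m.+1 (2 * K).+1 (fun t =>
  if t < j then (2 * ext f t).+1 else
  if t == j :> nat then 2 * ext f t else (2 * ext f t.-1).+1)%N; last by exists s.
- have jm := ltn_ord j; have := ext_le f t; case: (ltngtP t j) => tj; last by lia.
    have /(ext_ltn f) : (t < m)%N by lia.
    by lia.
  have /(ext_ltn f) : (t.-1 < m)%N by lia.
    by lia.
have jm := ltn_ord j.
have le v w : (v <= w)%N -> (v < m)%N -> (ext f v <= ext f w)%N.
  by rewrite leq_eqVlt => /orP[/eqP->//|vw] vm; apply/ltnW/ext_lt.
have lt v w : (v < m)%N -> (v < w)%N -> (ext f v < ext f w)%N by apply: ext_lt.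
case: (ltngtP u j) => uj; case: (ltngtP t j) => tj; try by lia.
- suff : (ext f t < ext f u)%N by lia.
  by apply: lt; lia.
- suff : (ext f t < ext f u.-1)%N by lia.
  by apply: lt; lia.
- suff : (ext f t.-1 < ext f u.-1)%N by lia.
  by apply: lt; lia.
- suff : (ext f t <= ext f u.-1)%N by lia.
  by apply: le; lia.
- suff : (ext f t < ext f u)%N by lia.
  by apply: lt; lia.
Qed.

Definition insert m K (j : 'I_m.+1) (f : incr m K) := sval (insert_def j f).

(** Horn filling: the [j]-th face is corrected by adding the images of the
    remaining [j]-th face under a degeneracy-like insertion of one point, whose
    lower faces vanish because the lower faces of the family do.  The points
    are doubled beforehand in order to make room. *)
Lemma filling_upto m K j : (j <= m.+1)%N -> exists K' (a : incr K K'),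
  forall x : 'I_m.+1 -> principal k m K, compatible x ->
  exists z : principal k m.+1 K', forall i : 'I_m.+1, (i < j)%N ->
    rcomp k (coface i) K' z = act _ a (x i).
Proof.
elim: j => [_|j IH jm].
  by exists K, (incr_id K) => x _; exists 0.
have [K1 [a fill_a]] := IH (ltnW jm); pose J : 'I_m.+1 := Ordinal jm.
have [t tK|t u tu uK|b bE] := @incr_of K1 (2 * K1).+1 (fun t => (2 * t).+1); do ?by lia.
exists (2 * K1).+1, (incr_comp b a) => x cx.
have [z zx] := fill_a x cx.
pose r i := act _ a (x i) - rcomp k (coface i) K1 z.
have cr : compatible r.
  move=> i i' n p q pq.
  by rewrite /r [LHS]homB [RHS]homB !act_rcomp !rcomp_comp (cx i i' n p q pq) pq.
have r0 (i : 'I_m.+1) : (i < j)%N -> r i = 0 by move=> ij; rewrite /r zx // subrr.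
exists (act _ b z + \sum_f (r J f : k) *: delta k (insert J f)) => i ij.
rewrite homD act_rcomp hom_sum.
under eq_bigr do rewrite homZ rcomp_delta.
(* For [i < j] the [i]-th face of [insert J f] does not involve [f i], so that it
   is governed by a face of [r J], which is one of [r i = 0]. *)
have [ij'|ji] := ltnP i j.
  rewrite zx // -act_comp -[RHS]addr0; congr (_ + _).
  have im : (i < m)%N by lia.
  have [e [q [em q_i ext_q]]] := omit_point (Ordinal im).
  have [p pq] : exists p : incr e m, incr_comp (coface i) p = incr_comp (coface J) q.
    apply: coface_factor => t; rewrite incr_compE; apply/eqP => /(congr1 val) /=.
    have qi : (q t != i :> nat) := q_i t.
    by rewrite cofaceE /= /bump; case: leqP; lia.
  apply: (push_zero (q := q)) => [|f g fg].
    by rewrite (cr J i _ q p (esym pq)) r0 // hom0.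
  apply: incr_eqn => t; rewrite !incr_compE !(svalP (insert_def _ _)) cofaceE.
  have ext_fg := ext_q _ _ _ _ fg; rewrite /= in ext_fg.
  rewrite /bump; case: (leqP i t) => it /=;
    by case: ltnP => tj; [|case: eqP => te]; rewrite ext_fg //; lia.
have {ij ji} -> : i = J by apply/val_inj => /=; lia.
have -> : \sum_f (r J f : k) *: delta k (incr_comp (insert J f) (coface J)) = act _ b (r J).
  rewrite act_delta_sum; apply: eq_bigr => f _; congr (_ *: delta _ _).
  apply: incr_eqn => t; rewrite !incr_compE (svalP (insert_def _ _)) cofaceE bE -ext_ord /bump /=.
  case: (leqP j t) => jt; rewrite ?add1n ?add0n /=.
    by case: (ltngtP t.+1 j); lia.
  by case: (ltngtP t j); lia.
by rewrite /r actB -act_comp addrCA subrr addr0.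
Qed.

Lemma filling m K : exists K' (a : incr K K'),
  forall x : 'I_m.+1 -> principal k m K, compatible x ->
  exists z : principal k m.+1 K', forall i, rcomp k (coface i) K' z = act _ a (x i).
Proof.
have [K' [a fill_a]] := @filling_upto m K m.+1 (leqnn _).
by exists K', a => x /fill_a[z zx]; exists z => i; apply: zx.
Qed.

(* In degree [d] the cube is the image of the socle; its restrictions to lower
   degrees vanish. *)
Lemma dual_family_base d : exists K (psi : incr d d -> principal k d K),
  (forall n, exists Psi : incr d n -> principal k n K, forall (q : incr n d) h,
     rcomp k q K (psi h) = \sum_(g | incr_comp q g == h) Psi g) /\
  forall h, rcomp k h K (psi h) != 0.
Proof.
exists (2 * d)%N, (fun _ => cube k d); split=> [n|h]; last first.
  by rewrite (incr_endo h) rcomp1 cube_neq0.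
exists (fun _ => \sum_(q : incr n d) rcomp k q _ (cube k d)) => q h.
have := incr_leq q; rewrite leq_eqVlt => /orP[/eqP nd|nd]; last first.
  by rewrite (cube_socle _ _ nd) big1 // => g; have := incr_leq g; lia.
subst n; rewrite (big_pred1 h) => [|g].
  by rewrite (sum_single (j := q)) // => q' /eqP[]; rewrite (incr_endo q) (incr_endo q').
by rewrite /= (incr_endo q) (incr_endo g) (incr_endo h) incr_comp1f !eqxx.
Qed.

(** Up to degree [N], the injective hull of the simple right module at [d] maps
    to the right module [n |-> k C([n],[K])], injectively at [d]: [psi h] is the
    image of the functional dual to [h], and [Psi] gives its restrictions. *)
Lemma dual_family d N : (d <= N)%N -> exists K (psi : incr d N -> principal k N K),
  (forall n, exists Psi : incr d n -> principal k n K, forall (q : incr n N) h,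
     rcomp k q K (psi h) = \sum_(g | incr_comp q g == h) Psi g) /\
  forall h, rcomp k h K (psi h) != 0.
Proof.
elim: N => [|N IH]; rewrite leq_eqVlt => /orP[/eqP<-|//]; do ?exact: dual_family_base.
rewrite ltnS => /[dup] dN /IH[K [psi [Psi_psi psi0]]].
have [K' [a fill_a]] := filling N K; exists K'.
(* The prescribed faces of the new chains; they are compatible because the
   restrictions of the old ones are those of the dual functionals. *)
pose x h i := \sum_(g | incr_comp (coface i) g == h) psi g.
have xE (h : incr d N.+1) n (Psi : incr d n -> principal k n K) i (p : incr n N) :
    (forall (q : incr n N) h, rcomp k q K (psi h) = \sum_(g | incr_comp q g == h) Psi g) ->
    rcomp k p K (x h i) = \sum_(g | incr_comp (incr_comp (coface i) p) g == h) Psi g.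
  move=> PsiE; rewrite hom_sum.
  rewrite [RHS](partition_big (incr_comp p) (fun g => incr_comp (coface i) g == h)).
    apply: eq_bigr => g /eqP gh; rewrite PsiE; apply: eq_bigl => g'.
    by rewrite incr_compA; case: eqP => [->|]; rewrite ?andbF // gh eqxx.
  by move=> g; rewrite incr_compA.
have cx h : compatible (x h).
  move=> i j n p q pq; have [Psi PsiE] := Psi_psi n.
  by rewrite !(xE _ _ Psi) // pq.
have [psi' psi'E] := choice (fun h => fill_a _ (cx h)).
exists psi'; split=> [n|h]; last first.
  have [i hi] := incr_misses h dN; have [r rh] := coface_factor hi.
  rewrite -{1}rh -rcomp_comp psi'E act_rcomp.
  apply: contra_neq (psi0 r) => /principal_torsion_free; rewrite /x.
  by rewrite (big_pred1 r) // => g; rewrite -{1}rh incr_comp_eq.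
have [->|nN] := eqVneq n N.+1.
  exists psi' => q h; rewrite (incr_endo q) rcomp1 (big_pred1 h) // => g.
  by rewrite incr_comp1f.
have [Psi PsiE] := Psi_psi n; exists (fun g => act _ a (Psi g)) => q h.
have qN : (n < N.+1)%N by rewrite ltn_neqAle nN (incr_leq q).
have [i qi] := incr_misses q qN; have [p pq] := coface_factor qi.
by rewrite -pq -rcomp_comp psi'E act_rcomp (xE _ _ Psi) // act_sum.
Qed.


Lemma hom_of_elt (V W : Cmod k) (h : hom V W) d (v : V d) n c :
  h n (of_elt v n c) = of_elt (h d v) n c.
Proof.
rewrite !of_eltE hom_sum; apply: eq_bigr => f _; by rewrite homZ hom_nat.
Qed.

Lemma of_elt_sum (V : Cmod k) d (I : finType) (a : I -> k) (v : I -> V d) n c :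
  of_elt (\sum_i a i *: v i) n c = \sum_i a i *: of_elt (v i) n c.
Proof.
rewrite of_eltE; under eq_bigr do rewrite act_sum scaler_sumr.
rewrite exchange_big; apply: eq_bigr => i _; rewrite of_eltE scaler_sumr.
by apply: eq_bigr => f _; rewrite actZ !scalerA mulrC.
Qed.

Lemma of_elt_principal d n K (u : principal k d n) (z : principal k n K) :
  of_elt u K z = \sum_q (u q : k) *: rcomp k q K z.
Proof. by rewrite {1}(delta_sum u) of_elt_sum. Qed.

Lemma subm_of_elt (V : Cmod k) (P : forall n, V n -> Prop) d (v : V d) n c :
  is_subm P -> P d v -> P n (of_elt v n c).
Proof.
by move=> sP Pv; apply: subm_sum => // f _; apply: submZ => //; apply: subm_act.
Qed.

Section Duality.
Variables (d N K s : nat) (lam : 'I_s -> incr d N -> k).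
Variable psi : incr d N -> principal k N K.
Let beta j := \sum_h lam j h *: psi h.

(** Translates of chains [u j] of degree [N] by the chains [beta j] add up to
    zero whenever [lam] kills all restrictions of [u]. *)
Lemma dual_combination n (u : 'I_s -> principal k n N)
    (Psi : incr d n -> principal k n K) :
  (forall (q : incr n N) h, rcomp k q K (psi h) = \sum_(g | incr_comp q g == h) Psi g) ->
  \sum_j of_elt (u j) K (beta j) =
  \sum_g (\sum_j \sum_h lam j h * (rcomp k g N (u j) h : k)) *: Psi g.
Proof.
move=> PsiE.
have rb q j : rcomp k q K (beta j) = \sum_g lam j (incr_comp q g) *: Psi g.
  rewrite /beta hom_sum.
  transitivity (\sum_h \sum_(g | incr_comp q g == h) lam j h *: Psi g).
    by apply: eq_bigr => h _; rewrite homZ PsiE scaler_sumr.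
  rewrite (exchange_big_dep predT) //=; apply: eq_bigr => g _.
  by rewrite (big_pred1 (incr_comp q g)) // => h; rewrite eq_sym.
have cE g j : \sum_h lam j h * (rcomp k g N (u j) h : k) =
    \sum_q lam j (incr_comp q g) * (u j q : k).
  under eq_bigr do rewrite rcomp_coef mulr_sumr.
  rewrite (exchange_big_dep predT) //=; apply: eq_bigr => q _.
  by rewrite (big_pred1 (incr_comp q g)) // => h; rewrite eq_sym.
under [RHS]eq_bigr do rewrite scaler_suml.
rewrite [RHS]exchange_big; apply: eq_bigr => j _.
rewrite of_elt_principal.
transitivity (\sum_q \sum_g (u j q : k) *: (lam j (incr_comp q g) *: Psi g)).
  by apply: eq_bigr => q _; rewrite rb scaler_sumr.
rewrite exchange_big; apply: eq_bigr => g _; rewrite cE scaler_suml.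
by apply: eq_bigr => q _; rewrite scalerA mulrC.
Qed.
End Duality.

(** The alternative between solvability of a linear system and a functional
    refuting it; the unknowns are the coefficients of [m]. *)
Lemma solve_or_separate d n N s (c : 'I_s -> principal k n N) (y : 'I_s -> principal k d N) :
  (exists m : principal k d n, forall j, y j = of_elt m N (c j)) \/
  exists lam : 'I_s -> incr d N -> k,
    (forall g : incr d n, \sum_j \sum_h lam j h * (rcomp k g N (c j) h : k) = 0) /\
    \sum_j \sum_h lam j h * (y j h : k) != 0.
Proof.
pose T := ('I_s * incr d N)%type.
pose B : 'M[k]_(#|{: incr d n}|, #|{: T}|) := \matrix_(i, t)
  (rcomp k (enum_val i) N (c (enum_val t).1) (enum_val t).2 : k).
pose v : 'rV[k]_(#|{: T}|) := \row_t (y (enum_val t).1 (enum_val t).2 : k).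
have [/submxP[u vuB]|/submxP vB] := boolP (v <= B)%MS.
  left; exists (\sum_i u 0 i *: delta k (enum_val i)) => j.
  rewrite of_elt_sum; apply/ffunP => g; rewrite sum_ffunE.
  have := congr1 (fun w : 'rV_ _ => w 0 (enum_rank (j, g))) vuB.
  by rewrite !mxE enum_rankK /= => ->; apply: eq_bigr => i _; rewrite !ffunE !mxE enum_rankK.
right; have /rV0Pn[t0 vt0] : v *m cokermx B != 0.
  by apply/eqP => v0; apply: vB; apply/submxP; rewrite submxE v0.
pose lam j h := cokermx B (enum_rank ((j, h) : T)) t0.
have sumE (F : 'I_s -> incr d N -> k) :
    \sum_j \sum_h lam j h * F j h =
    \sum_t F (enum_val t).1 (enum_val t).2 * cokermx B t t0.
  rewrite pair_bigA [RHS](reindex (@enum_rank T)) /=; last exact/onW_bij/enum_rank_bij.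
  by apply: eq_bigr => -[j h] _; rewrite enum_rankK mulrC.
exists lam; split=> [g|]; rewrite (sumE (fun j h => _)).
  have := congr1 (fun w : 'M_(_, _) => w (enum_rank g) t0) (mulmx_coker B).
  rewrite mxE [RHS]mxE => BE; rewrite -[RHS]BE; apply: eq_bigr => t _.
  by rewrite [B _ _]mxE enum_rankK.
apply: contra_neq vt0 => yE; rewrite mxE -[RHS]yE; apply: eq_bigr => t _.
by rewrite [v _ _]mxE.
Qed.

(** Self-injectivity of the principal modules: a functional graph over a
    submodule of [M(n)] extends.  By noetherianity only finitely many elements,
    all in one degree [N], need be considered; if no extension existed, the
    dual family would combine them to an element [(0, y)] with [y != 0]. *)
Lemma extend_principal d n (J : forall N, dsum (principal k n) (principal k d) N -> Prop) :
  is_subm J -> functional J ->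
  exists m : principal k d n, forall N c y, J N (c, y) -> y = of_elt m N c.
Proof.
move=> sJ fJ.
have [l [Jl gl]] := noetherian_dsum (@noetherian_principal k n) (@noetherian_principal k d) sJ.
have [N lN] : exists N, forall g, List.In g l -> (tag g <= N)%N.
  elim: (l) => [|g l' [N lN]]; first by exists 0%N.
  exists (maxn (tag g) N) => h [<-|/lN]; rewrite leq_max ?leqnn // => ->.
  by rewrite orbT.
pose sol m M (x : dsum (principal k n) (principal k d) M) := x.2 = of_elt m M x.1.
(* Equations may be moved to degree [N], as [M(d)] is torsion free. *)
have [xs [Jxs solxs]] : exists xs : seq (dsum (principal k n) (principal k d) N),
    (forall x, List.In x xs -> J N x) /\ forall m : principal k d n,
    (forall x, List.In x xs -> sol m N x) -> forall g, List.In g l -> sol m _ (tagged g).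
  elim: l Jl lN {gl} => [|g l IH] Jl lN; first by exists [::].
  have [xs [Jxs solxs]] := IH (fun h hl => Jl h (or_intror hl)) (fun h hl => lN h (or_intror hl)).
  have [a _] := incr_widen (lN g (or_introl erefl)).
  exists (act _ a (tagged g) :: xs); split=> [x [<-|/Jxs//]|m solm h].
    by apply: subm_act => //; apply: Jl; left.
  case=> [<-|hl]; last by apply: (solxs m) => // x xxs; apply: solm; right.
  have : act _ a (tagged g).2 = of_elt m N (act _ a (tagged g).1) := solm _ (or_introl erefl).
  rewrite hom_nat => /eqP; rewrite -subr_eq0 -actB => /eqP/principal_torsion_free/eqP.
  by rewrite subr_eq0 => /eqP.
have in_xs (j : 'I_(size xs)) : List.In (tnth (in_tuple xs) j) xs.
  rewrite (tnth_nth 0); elim: (xs) (j : nat) (ltn_ord j) => //= x xs' IH [|i] ij.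
    by left.
  by right; apply: IH.
have xs_in x : List.In x xs -> exists j, x = tnth (in_tuple xs) j.
  move=> xxs; have [i ij ->] : exists2 i, (i < size xs)%N & x = nth 0 xs i.
    elim: (xs) xxs => //= x' xs' IH [->|/IH[i ij ->]]; first by exists 0%N.
    by exists i.+1.
  by exists (Ordinal ij); rewrite (tnth_nth 0).
pose c j := (tnth (in_tuple xs) j).1; pose y j := (tnth (in_tuple xs) j).2.
have [[m my]|[lam [lamc lamy]]] := solve_or_separate c y.
  exists m => M c' y' Jcy.
  apply: (gl (fun M x => sol m M x) _ _ _ _ Jcy) => [|g gl']; last first.
    by apply: solxs => // x /xs_in[j ->]; apply: my.
  split=> [M'|M' z u v su sv|M1 M2 f u su]; first by rewrite /sol hom0.
  - by rewrite /sol -[RHS]/(of_elt m M' (z *: u.1 + v.1)) homD homZ -su -sv.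
  - by rewrite /sol -[RHS]/(of_elt m M2 (act _ f u.1)) hom_nat -su.
have dN : (d <= N)%N.
  apply: contra_neqT lamy => dN; rewrite big1 // => j _; rewrite big1 // => h _.
  by have := incr_leq h; rewrite (negPf dN).
have [K [psi [Psi_psi psi0]]] := dual_family dN.
have [Psin PsinE] := Psi_psi n; have [Psid PsidE] := Psi_psi d.
pose beta j := \sum_h lam j h *: psi h.
pose X := \sum_j of_elt (tnth (in_tuple xs) j) K (beta j).
have JX : J K X by apply: subm_sum => // j _; apply: subm_of_elt => //; apply: Jxs.
have X1 : X.1 = 0.
  rewrite -[X.1]/(fst_hom _ _ K X) hom_sum.
  under eq_bigr do rewrite hom_of_elt.
  rewrite (dual_combination lam c PsinE).
  by rewrite big1 // => g _; rewrite lamc scale0r.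
have X2 : X.2 = (\sum_j \sum_h lam j h * (y j h : k)) *: Psid (incr_id d).
  rewrite -[X.2]/(snd_hom _ _ K X) hom_sum.
  under eq_bigr do rewrite hom_of_elt.
  rewrite (dual_combination lam y PsidE).
  rewrite (sum_single (j := incr_id d)) => [|g]; last by rewrite (incr_endo g) eqxx.
  by congr (_ *: _); apply: eq_bigr => j _; rewrite rcomp1.
have Psid0 : Psid (incr_id d) != 0.
  have [h _] := incr_widen dN; have := psi0 h; rewrite PsidE (big_pred1 (incr_id d)) // => g /=.
  by rewrite (incr_endo g) incr_compf1 !eqxx.
have := fJ K X.2; rewrite -X1 -surjective_pairing => /(_ JX) /eqP.
by rewrite X2 scaler_eq0 (negPf lamy) (negPf Psid0).
Qed.

(** Injectivity of [M(d)] relative to finitely generated modules, for partial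
    morphisms given by their graphs: extend over one generator after the other. *)
Theorem extend_hom d (B : Cmod k) (G : forall n, dsum B (principal k d) n -> Prop) :
  finitely_generated B -> is_subm G -> functional G ->
  exists h : hom B (principal k d), forall n x y, G n (x, y) -> h n x = y.
Proof.
move=> /fg_noetherian nB sG fG; have [l [_ gl]] := nB _ (@subm_all _ B).
suff [G' [sG' fG' GG' lG']] : exists G' : forall n, dsum B (principal k d) n -> Prop,
    [/\ is_subm G', functional G', forall n x, G n x -> G' n x &
        forall g, List.In g l -> exists y, G' _ (tagged g, y)].
  have tG' : total G'.
    move=> n x; have := gl (fun n x => exists y, G' n (x, y)); apply=> //.
    split=> [m|m c u v [u' Gu] [v' Gv]|m m' a u [u' Gu]].
    - by exists 0; apply: (subm0 sG').
    - by exists (c *: u' + v'); apply: (subm_lin sG' c Gu Gv).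
    - by exists (act _ a u'); apply: (subm_act sG' a Gu).
  have [h hE] := graph_hom sG' fG' tG'.
  by exists h => n x y /GG'/hE.
elim: l {gl} => [|[n b] l [G' [sG' fG' GG' lG']]]; first by exists G.
(* The conditions on the value [m] at the next generator [b]. *)
pose J N (cy : dsum (principal k n) (principal k d) N) := G' N (of_elt b N cy.1, cy.2).
have [||m mE] := @extend_principal d n J.
- exact: (subm_preim (pair_hom (hom_comp (of_elt b) (fst_hom _ _)) (snd_hom _ _)) sG').
- by move=> N y Jy; have : G' N (of_elt b N 0, y) := Jy; rewrite hom0; apply: fG'.
pose G2 N (x : dsum B (principal k d) N) :=
  exists2 c, True & G' N (x.1 - of_elt b N c, x.2 - of_elt m N c).
exists G2; split.
- split=> [N|N a x y [c _ Gx] [c' _ Gy]|N N' a x [c _ Gx]].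
  + by exists 0; rewrite // !hom0 !subr0; apply: (subm0 sG').
  + exists (a *: c + c'); rewrite // !homD !homZ !opprD.
    have := subm_lin sG' a Gx Gy.
    rewrite -[_ *: _ + _]/(a *: (x.1 - _) + (y.1 - _), a *: (x.2 - _) + (y.2 - _)).
    by rewrite !scalerBr ![_ - _ + (_ - _)]addrACA.
  + by exists (act _ a c); rewrite // !hom_nat -!actB; apply: (subm_act sG' a Gx).
- move=> N y [c _ /=]; rewrite sub0r => Gc.
  have : G' N (- (- of_elt b N c, y - of_elt m N c)) by apply: (submN sG').
  rewrite -[- (_, _)]/(- _, - _) opprK opprB => /mE/eqP.
  rewrite -subr_eq0 addrAC subrr sub0r oppr_eq0.
  by move/eqP.
- by move=> N x /GG' Gx; exists 0; rewrite // !hom0 !subr0 -surjective_pairing.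
- move=> g [<-|/lG'[y Gy]]; last by exists y, 0; rewrite // !hom0 !subr0.
  exists m, (delta k (incr_id n)) => //.
  have : G' n (b - of_elt b n (delta k (incr_id n)), m - of_elt m n (delta k (incr_id n))).
    by rewrite !of_elt_id !subrr; apply: (subm0 sG').
  by [].
Qed.

End Filling.

(** * Sheaves and saturated modules *)

Section Sheaves.
Variable k : fieldType.
Implicit Types V W : Cmod k.

(** The sheaf condition for the atomic topology: an element that cannot
    distinguish two maps agreeing on the image of [a] comes from the source. *)
Definition descent V := forall m n (a : incr m n) (y : V n),
  (forall p (b b' : incr n p), incr_comp b a = incr_comp b' a ->
     act V b y = act V b' y) ->
  exists x, act V a x = y.

Definition sheaf V := torsion_free V /\ descent V.

Lemma torsion_free_eq V m n (a : incr m n) (x y : V m) :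
  torsion_free V -> act V a x = act V a y -> x = y.
Proof.
move=> tV /eqP; rewrite -subr_eq0 -actB => /eqP/tV/eqP.
by rewrite subr_eq0 => /eqP.
Qed.

(** If [f] in the support of [y] had a point [p] outside the image of [a], the
    two maps that open a gap after, resp. before [p] would move [y] to two
    chains only one of which may contain [p]. *)
Lemma sheaf_principal d : sheaf (principal k d).
Proof.
split=> [|m n a y desc]; first exact: principal_torsion_free.
have supp (f : incr d n) : y f != 0 -> exists g, incr_comp a g = f.
  move=> yf; apply: incr_factor => i.
  apply/not_existsP => fa.
  pose b : incr n n.+1 := coface (lift ord0 (f i)).
  pose b' : incr n n.+1 := coface (inord (f i)).
  have b'i : (inord (f i) : 'I_n.+1) = f i :> nat by rewrite inordK // ltnW // ltnS.
  have bb' : incr_comp b a = incr_comp b' a.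
    apply: incr_eqn => t; rewrite !incr_compE !cofaceE b'i lift0 /bump.
    have : a t != f i :> nat by apply/eqP => /val_inj /fa.
    by case: leqP; case: leqP; lia.
  have /ffunP/(_ (incr_comp b f)) := desc _ _ _ bb'.
  rewrite !act_delta_sum !delta_sumE (big_pred1 f) => [|g]; last exact: incr_comp_eq.
  rewrite big1 => [|g /eqP gf]; first exact/eqP.
  have := congr1 (fun h : incr _ _ => nat_of_ord (h i)) gf.
  rewrite !incr_compE !cofaceE b'i lift0 /bump.
  by case: leqP; case: leqP; lia.
exists [ffun g => y (incr_comp a g)]; apply/ffunP => f; rewrite act_delta_sum delta_sumE.
have [yf|/supp[g gf]] := eqVneq (y f) 0.
  by rewrite yf big1 // => g /eqP gf; rewrite ffunE gf.
rewrite (big_pred1 g) => [|h /=]; first by rewrite ffunE gf.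
by rewrite -gf incr_comp_eq.
Qed.

Lemma sheaf_dsum V W : sheaf V -> sheaf W -> sheaf (dsum V W).
Proof.
move=> [tV dV] [tW dW]; split=> [m n a x ax|m n a y desc].
  have /tV x1 : act V a x.1 = 0 by have := congr1 fst ax.
  have /tW x2 : act W a x.2 = 0 by have := congr1 snd ax.
  by rewrite [x]surjective_pairing x1 x2.
have [p b b' /desc/(congr1 fst)//|x1 x1E] := dV m n a y.1.
have [p b b' /desc/(congr1 snd)//|x2 x2E] := dW m n a y.2.
by exists (x1, x2); rewrite [y]surjective_pairing -x1E -x2E.
Qed.

Lemma sheaf_principal_sum s : sheaf (principal_sum k s).
Proof.
elim: s => [|d s IH] /=; last exact: sheaf_dsum (sheaf_principal d) IH.
split=> [m n a x ax|m n a y _].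
  by rewrite (thinmx0 x).
by exists 0; rewrite (thinmx0 y) [LHS]thinmx0.
Qed.

Lemma sheaf_sub V (P : forall n, V n -> Prop) (sP : is_subm P) :
  sheaf V -> (forall m n (a : incr m n) x, P n (act V a x) -> P m x) ->
  sheaf (sub_cmod sP).
Proof.
move=> [tV dV] Pa; split=> [m n a x ax|m n a y desc].
  apply: (@sub_incl_inj _ _ _ sP); rewrite hom0; apply: (tV _ _ a).
  by rewrite -hom_nat ax hom0.
have [p b b' /desc bb'|x xE] := dV m n a (sub_incl sP n y).
  by rewrite -!hom_nat bb'.
have [|x' x'E] := @sub_incl_surj _ _ _ sP m x.
  by apply: (Pa _ _ a); rewrite xE; apply: sub_inclP.
by exists x'; apply: (@sub_incl_inj _ _ _ sP); rewrite hom_nat x'E.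
Qed.

Lemma sheaf_ker V W (f : hom V W) : sheaf V -> torsion_free W ->
  sheaf (sub_cmod (subm_ker f)).
Proof.
by move=> sV tW; apply: sheaf_sub => // m n a x; rewrite hom_nat => /tW.
Qed.

Lemma torsion_eltP V n (v : V n) : (exists p (a : incr n p), act V a v = 0) <-> torsion_elt v.
Proof.
split=> [[p [a av]]|[s [a av]]]; last by exists (n + s)%N, a.
exists (p - n)%N; have : p = (n + (p - n))%N by rewrite subnKC // (incr_leq a).
by move: (p - n)%N => s ps; subst p; exists a.
Qed.

(** An extension of a torsion module by a sheaf [V] splits: an element of the
    extension is moved into [V], and the result descends. *)
Lemma sheaf_saturated V : sheaf V -> saturated V.
Proof.
move=> [tV dV] T torT; split=> [f n x|E i p [inji surjp exE]].
  have /torsion_eltP[q [a ax]] := torT n x.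
  by apply: (tV _ _ a); rewrite -hom_nat ax hom0.
(* The retraction [r : E -> V]. *)
pose G n (x : dsum E V n) := exists q (a : incr n q), act E a x.1 = i q (act V a x.2).
have sG : is_subm G.
  have -> : G = closure (V := dsum E V) (fun n x => x.1 = i n x.2) by [].
  apply: closure_subm; split=> [n|n c x y xE yE|m n a x xE] /=.
  - by rewrite hom0.
  - by rewrite homD homZ xE yE.
  - by rewrite hom_nat -xE.
have fG : functional G.
  move=> n y [q [a /=]]; rewrite act0 => e; apply: (tV _ _ a).
  by apply: (inji q); rewrite hom0.
have tG : total G.
  move=> n x; have /torsion_eltP[q [a apx]] := torT n (p n x).
  have [y yE] : exists y, i q y = act E a x by apply/exE; rewrite hom_nat.
  have [|v vE] := dV n q a y; last by exists v, q, a; rewrite /= vE yE.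
  move=> r b b' bb'; apply: (inji r); rewrite !hom_nat yE.
  by rewrite -!act_comp bb'.
have [r rE] := graph_hom sG fG tG.
have ri n v : r n (i n v) = v.
  by apply/rE; exists n, (incr_id n); rewrite /= !act_id.
(* The section maps [t] to its preimage in the kernel of [r]. *)
pose H n (x : dsum T E n) := p n x.2 = x.1 /\ r n x.2 = 0.
have sH : is_subm H.
  split=> [n|n c x y [px rx] [py ry]|m n a x [px rx]]; rewrite /H /=.
  - by rewrite !hom0.
  - by rewrite !homD !homZ px py rx ry scaler0 addr0.
  - by rewrite !hom_nat px rx act0.
have fH : functional H.
  move=> n x [/exE[v /= vx] rx]; have : r n x = 0 := rx.
  by rewrite -vx ri => ->; rewrite hom0.
have tH : total H.
  move=> n t; have [x xt] := surjp n t.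
  exists (x - i n (r n x)); split; rewrite homB ?ri ?subrr //=.
  have -> : p n (i n (r n x)) = 0 by apply/exE; exists (r n x).
  by rewrite subr0.
have [s sE] := graph_hom sH fH tH; exists s => n t.
by have /sE[] : s n t = s n t.
Qed.

(** The inclusion of the torsion submodule is a morphism from a torsion module. *)
Lemma saturated_torsion_free V : saturated V -> torsion_free V.
Proof.
move=> satV m n a x ax.
pose P p (v : V p) := closure (fun n (v : V n) => v = 0) v.
have sP : is_subm P.
  apply: closure_subm; split=> [//|q c u v -> ->|q r b u ->].
    by rewrite scaler0 addr0.
  by rewrite act0.
have torT : torsion (sub_cmod sP).
  move=> q v; apply/torsion_eltP; have [r [b bv]] := sub_inclP v.
  by exists r, b; apply: (@sub_incl_inj _ _ _ sP); rewrite hom_nat bv hom0.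
have [x' <-] : exists x', sub_incl sP m x' = x by apply: sub_incl_surj; exists n, a.
by have [H _] := satV _ torT; apply: H.
Qed.

(** The torsion closure of [V] in a torsion free module is an extension of
    [V], split because its quotient is torsion; but the complement embeds in a
    torsion free module. *)
Lemma saturated_closed V W (i : hom V W) : saturated V -> torsion_free W ->
  (forall n, injective (i n)) ->
  closed (fun n w => exists v, i n v = w).
Proof.
move=> satV tW inji n w0 clw0.
pose P p (w : W p) := closure (fun n w => exists2 v, True & i n v = w) w.
have sP : is_subm P by apply/closure_subm/subm_im/subm_all.
pose E := sub_cmod sP; pose j := sub_incl sP.
have [i' i'E] : exists i' : hom V E, forall q v, j q (i' q v) = i q v.
  by apply: sub_lift => q v; apply: closure_sub; exists v.
pose Q q (x : E q) := exists2 v, True & i' q v = x.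
have sQ : is_subm Q by apply/subm_im/subm_all.
pose T := quot_cmod sQ; pose p := quot_proj sQ.
have torT : torsion T.
  move=> q t; have [x <-] := quot_proj_surj t; apply/torsion_eltP.
  have [r [a [v _ vE]]] := sub_inclP x; exists r, a.
  rewrite -hom_nat; apply/quot_proj_eq0; exists v => //.
  by apply: (@sub_incl_inj _ _ _ sP); rewrite hom_nat -vE -i'E.
have [_ splitT] := satV T torT.
have [|s sE] := splitT E i' p.
  split=> [q u v uv|q y|q x].
  - by apply: (inji q); rewrite -!i'E uv.
  - exact: quot_proj_surj.
  - split=> [/quot_proj_eq0[v _ <-]|[v <-]]; first by exists v.
    by apply/quot_proj_eq0; exists v.
have [x xw] : exists x, j n x = w0.
  apply: sub_incl_surj; have [q [a [v vE]]] := clw0; by exists q, a, v.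
have sp0 : s n (p n x) = 0.
  have /torsion_eltP[q [a a0]] := torT n (p n x).
  apply: (@sub_incl_inj _ _ _ sP); rewrite hom0; apply: (tW _ _ a).
  by rewrite -hom_nat -hom_nat a0 !hom0.
have /quot_proj_eq0[v _ vx] : p n x = 0.
  by have := sE n (p n x); rewrite hom_compE hom_idE sp0 hom0.
by exists v; rewrite -i'E vx xw.
Qed.

End Sheaves.

Section Towers.
Variables (k : fieldType) (W : Cmod k).
Implicit Types (l : seq {e & hom W (principal k e)}) (P : forall n, W n -> Prop).

Definition killed_by l n (x : W n) : Prop :=
  forall f, List.In f l -> tagged f n x = 0.

(** The successive common kernels filter [P], with zero as the last term; each
    step of the filtration embeds in the socle of a principal module. *)
Fixpoint tower P l : Prop :=
  if l is f :: l' then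
    (forall n x, P n x -> socle (tagged f n x)) /\
    tower (fun n x => P n x /\ tagged f n x = 0) l'
  else forall n x, P n x -> x = 0.

Lemma tower_impl P Q l : (forall n x, P n x -> Q n x) -> tower Q l -> tower P l.
Proof.
elim: l P Q => [|f l IH] P Q PQ /=; first by move=> Q0 n x /PQ/Q0.
move=> [Qf tQ]; split=> [n x /PQ/Qf//|]; apply: IH tQ => n x [/PQ Qx fx //].
Qed.


Lemma tower_cat P l1 l2 :
  (forall f, List.In f l1 -> forall n x, P n x -> socle (tagged f n x)) ->
  tower (fun n x => P n x /\ killed_by l1 x) l2 -> tower P (l1 ++ l2).
Proof.
elim: l1 P => [|f l1 IH] P Pl1 tl2 /=.
  by apply: tower_impl tl2 => n x Px; split.
split=> [|]; first by apply: Pl1; left.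
apply: IH => [g gl n x [Px _]|]; first by apply: Pl1 => //; right.
by apply: tower_impl tl2 => n x [[Px fx] kx]; split=> // g [<-|/kx].
Qed.

End Towers.

Section TowerExistence.
Variable k : fieldType.

Definition tower_map (V W : Cmod k) (h : hom V W) (l : seq {e & hom W (principal k e)}) :
    seq {e & hom V (principal k e)} :=
  [seq existT (fun e => hom V (principal k e)) (tag f) (hom_comp (tagged f) h) | f <- l].

Lemma tower_comp (V W : Cmod k) (h : hom V W) (P : forall n, V n -> Prop)
    (Q : forall n, W n -> Prop) l :
  (forall n x, P n x -> Q n (h n x)) -> (forall n x, P n x -> h n x = 0 -> x = 0) ->
  tower Q l -> tower P (tower_map h l).
Proof.
elim: l P Q => [|f l IH] P Q PQ P0 /=; first by move=> Q0 n x Px; apply: P0 => //; apply/Q0/PQ.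
move=> [Qf tQ]; split=> [n x /PQ/Qf//|].
by apply: IH tQ => [n x [/PQ Qx fx]|n x [Px _]] //; apply: P0.
Qed.

Definition faces d e : seq {e & hom (principal k d) (principal k e)} :=
  [seq existT (fun e => hom (principal k d) (principal k e)) e (rcomp k q)
  | q <- enum {: incr e d}].

Lemma killed_faces d e n (x : principal k d n) :
  killed_by (faces d e) x <-> forall q : incr e d, rcomp k q n x = 0.
Proof.
split=> [kx q|kx f /List.in_map_iff[q [<- _]]]; last exact: kx.
apply: (kx (existT _ e (rcomp k q))).
apply: (List.in_map (fun q => existT (fun e => hom _ (principal k e)) e (rcomp k q))).
by apply: mem_In; rewrite mem_enum.
Qed.

(** In the order of increasing size the faces of a face come before it, so that
    each face maps the common kernel of its predecessors to the socle; the last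
    face is the identity, which makes the common kernel of all faces zero. *)
Lemma tower_principal d : exists l, tower (fun n (_ : principal k d n) => True) l.
Proof.
suff H m e (P : forall n, principal k d n -> Prop) : (e + m = d.+1)%N ->
    (forall n x, P n x -> forall e' (q : incr e' d), (e' < e)%N -> rcomp k q n x = 0) ->
    exists l, tower P l.
  by apply: (H d.+1 0%N).
elim: m e P => [|m IH] e P em Pe.
  exists [::] => n x Px; rewrite -[x]rcomp1; apply: (Pe n x Px).
  by rewrite -em addn0.
have [||l tl] := IH e.+1 (fun n x => P n x /\ killed_by (faces d e) x).
- by rewrite -em addSnnS.
- move=> n x [Px /killed_faces kx] e' q; rewrite ltnS leq_eqVlt => /orP[/eqP ee|]; last exact: Pe.
  by subst e'.
exists (faces d e ++ l); apply: tower_cat => // f /List.in_map_iff[q [<- _]] n x Px.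
by move=> e' r e'e; rewrite [LHS]rcomp_comp; apply: Pe Px _ _ e'e.
Qed.

Lemma tower_principal_sum s : exists l, tower (fun n (_ : principal_sum k s n) => True) l.
Proof.
elim: s => [|d s [l tl]]; first by exists [::] => n x _; rewrite (thinmx0 x).
have [l1 tl1] := tower_principal d.
pose V := dsum (principal k d) (principal_sum k s).
exists (tower_map (fst_hom _ _) l1 ++ tower_map (snd_hom _ _) l).
have cat2 (P : forall n, principal k d n -> Prop) (Q : forall n, V n -> Prop) l0 l' :
    tower P l0 -> (forall n x, Q n x -> P n x.1) ->
    tower (fun n x => Q n x /\ x.1 = 0) l' -> tower Q (tower_map (fst_hom _ _) l0 ++ l').
  elim: l0 P Q => [|f l0 IH] P Q /=.
    move=> P0 QP; apply: tower_impl => n x Qx; split=> //; exact/P0/QP.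
  move=> [Pf tP] QP tQ; split=> [n x /QP/Pf//|]; apply: IH tP _ _ => [n x [/QP Px fx]//|].
  by apply: tower_impl tQ => n x [[Qx _] x1].
apply: cat2 tl1 _ _ => //.
apply: tower_comp tl => // n x [_ x1] x2.
by rewrite [x]surjective_pairing x1; congr pair.
Qed.

(** Along a tower, [J] meets each step either in the kernel of its socle-valued
    morphism [f], which then extends to a morphism killing [J], or in a
    submodule with dense image in the socle; so that moving an element of the
    common kernel of these extensions brings it one step further down
    modulo [J]. *)
Lemma separating_family (W : Cmod k) (J : forall n, W n -> Prop)
    (l : seq {e & hom W (principal k e)}) :
  finitely_generated W -> is_subm J -> closed J -> tower (fun n _ => True) l ->
  exists chi : seq {e & hom W (principal k e)},
    (forall f, List.In f chi -> forall n x, J n x -> tagged f n x = 0) /\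
    forall n x, killed_by chi x -> J n x.
Proof.
move=> fgW sJ cJ.
suff H (P : forall n, W n -> Prop) : is_subm P -> tower P l ->
  exists chi : seq {e & hom W (principal k e)},
    (forall f, List.In f chi -> forall n x, J n x -> tagged f n x = 0) /\
    forall n x, killed_by chi x ->
      closure (fun n x => exists2 y, J n y & P n (x - y)) x -> J n x.
  move=> tl; have [chi [Jchi chiJ]] := H _ (@subm_all _ W) tl.
  exists chi; split=> // n x kx; apply: chiJ => //; apply: closure_sub.
  by exists 0 => //; apply: subm0.
elim: l P => [|[e f] l IH] P sP /=.
  move=> P0; exists [::]; split=> // n x _ [p [a [y Jy /P0/eqP]]].
  by rewrite subr_eq0 => /eqP axy; apply: cJ; exists p, a; rewrite axy.
move=> [fP tl].
have sP' : is_subm (fun n x => P n x /\ f n x = 0) := subm_cap sP (subm_ker f).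
have [chi [Jchi chiJ]] := IH _ sP' tl.
have sJP := subm_cap sJ sP.
have [J0|] := pselect (forall n x, J n x -> P n x -> f n x = 0).
  (* [f] on [P] and [0] on [J] agree on the intersection. *)
  pose G n (x : dsum W (principal k e) n) :=
    exists2 y, J n y & P n (x.1 - y) /\ x.2 = f n (x.1 - y).
  have sG : is_subm G.
    split=> [n|n c x y [u Ju [Pu fu]] [v Jv [Pv fv]]|m n a x [u Ju [Pu fu]]].
    - by exists 0; rewrite ?subr0 ?hom0; [apply: subm0 | split; first apply: subm0].
    - exists (c *: u + v); first exact: subm_lin.
      have E : (c *: x + y).1 - (c *: u + v) = c *: (x.1 - u) + (y.1 - v).
        by rewrite scalerBr addrACA opprD.
      rewrite E homD homZ -fu -fv; split=> //; exact: subm_lin.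
    - exists (act W a u); first exact: subm_act.
      rewrite -[(act _ a x).1]/(act W a x.1) -[(act _ a x).2]/(act (principal k e) a x.2).
      by rewrite -actB hom_nat fu; split=> //; apply: subm_act.
  have fG : functional G.
    move=> n y [u Ju /= [Pu ->]]; rewrite sub0r in Pu *; apply: J0 => //.
    exact: submN.
  have [h hG] := extend_hom fgW sG fG.
  have hJ n x : J n x -> h n x = 0.
    move=> Jx; apply: hG; exists x => //=; rewrite subrr hom0; split=> //; exact: subm0.
  have hP n x : P n x -> h n x = f n x.
    move=> Px; apply: hG; exists 0 => /=; first exact: subm0.
    by rewrite subr0.
  exists (existT _ e h :: chi); split=> [g [<-//|/Jchi//]|n x kx [p [a [y Jy Pxy]]]].
  apply: chiJ => [g gchi|]; first by apply: kx; right.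
  exists p, a, y => //; split=> //.
  rewrite -hP // homB (hJ _ y) // hom_nat.
  by have -> : h n x = 0 by [apply: (kx (existT _ e h)); left]; rewrite act0 subr0.
move=> /existsNP[m /existsNP[u]] /not_implyP[Ju /not_implyP[Pu /eqP fu]].
exists chi; split=> // n x kx [p [a [y Jy Pxy]]]; apply: chiJ => //.
have [q [b [v [Jv Pv] fv]]] := socle_dense (subm_im f sJP)
  (ex_intro2 _ _ u (conj Ju Pu) erefl) fu (fP _ _ Pxy).
exists q, (incr_comp b a), (act W b y + v).
  by apply: submD => //; apply: subm_act.
have E : act W (incr_comp b a) x - (act W b y + v) = act W b (act W a x - y) - v.
  by rewrite act_comp actB opprD addrA.
rewrite E; split; first by apply: submB => //; apply: subm_act.
by rewrite homB hom_nat fv subrr.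
Qed.

(** A separating family on a sum of principal modules that covers [W] kills the
    kernel of the covering, so that it descends to [W]. *)
Theorem cogeneration (W : Cmod k) (J : forall n, W n -> Prop) :
  finitely_generated W -> is_subm J -> closed J ->
  exists chi : seq {e & hom W (principal k e)},
    forall n x, killed_by chi x <-> J n x.
Proof.
move=> [s [g gsurj]] sJ cJ; have [l tl] := tower_principal_sum s.
have fgS : finitely_generated (principal_sum k s).
  by apply/noetherian_fg/noetherian_principal_sum.
have [|chi [Jchi chiJ]] := separating_family fgS (subm_preim g sJ) _ tl.
  by move=> n x [p [a]]; rewrite hom_nat => Ja; apply: cJ; exists p, a.
have desc (f : {e & hom (principal_sum k s) (principal k e)}) : List.In f chi ->
    exists h : hom W (principal k (tag f)), forall n x, h n (g n x) = tagged f n x.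
  move=> fchi.
  pose G n (y : dsum W (principal k (tag f)) n) :=
    exists2 x, True & pair_hom g (tagged f) n x = y.
  have sG : is_subm G by apply/subm_im/subm_all.
  have [n y [x _ [gx <-]]|n y|h hE] := graph_hom sG.
  - by apply: (Jchi f fchi); rewrite gx; apply: subm0.
  - by have [x gx] := gsurj n y; exists (tagged f n x), x; rewrite // pair_homE gx.
  - by exists h => n x; apply/hE; exists x.
have [chi' chi'E] : exists chi' : seq {e & hom W (principal k e)},
    forall n x, killed_by chi' (g n x) <-> killed_by chi x.
  elim: chi desc {Jchi chiJ} => [|f chi IH] desc.
    by exists [::] => n x; split=> _ f [].
  have [chi' chi'E] := IH (fun h hchi => desc h (or_intror hchi)).
  have [h hE] := desc f (or_introl erefl).
  exists (existT _ (tag f) h :: chi') => n x; split=> kx.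
    move=> u [<-|uchi]; first by rewrite -hE; apply: (kx (existT _ (tag f) h)); left.
    have /chi'E := (fun v vchi => kx v (or_intror vchi)); exact.
  move=> u [<-|uchi]; first by rewrite /= hE; apply: kx; left.
  have /chi'E := (fun v vchi => kx v (or_intror vchi)); exact.
exists chi' => n y; have [x <-] := gsurj n y; rewrite chi'E; split=> [/chiJ//|Jx f fchi].
exact: Jchi.
Qed.

End TowerExistence.

(** * Injective resolutions and finite length *)

Section Saturated.
Variable k : fieldType.

Fixpoint tuple_hom (W : Cmod k) (l : seq {e & hom W (principal k e)}) :
    hom W (principal_sum k (map tag l)) :=
  if l is f :: l' then pair_hom (tagged f) (tuple_hom l') else zero_hom W _.

Lemma tuple_hom_eq0 (W : Cmod k) (l : seq {e & hom W (principal k e)}) n (x : W n) :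
  tuple_hom l n x = 0 <-> killed_by l x.
Proof.
elim: l => [|f l IH]; first by split=> [_ f []|].
split=> [fx g|kx].
  have /IH kx : tuple_hom l n x = 0 by have := congr1 snd fx.
  by case=> [<-|/kx//]; have := congr1 fst fx.
have /IH lx : killed_by l x by move=> g gl; apply: kx; right.
have fx : tagged f n x = 0 by apply: kx; left.
by have : (tagged f n x, tuple_hom l n x) = 0 by rewrite fx lx.
Qed.

Lemma hom_inj (V W : Cmod k) (h : hom V W) :
  (forall n x, h n x = 0 -> x = 0) -> forall n, injective (h n).
Proof.
move=> h0 n x y /eqP; rewrite -subr_eq0 -homB => /eqP/h0/eqP.
by rewrite subr_eq0 => /eqP.
Qed.

Lemma principal_embedding (V : Cmod k) : finitely_generated V -> torsion_free V ->
  exists s (j : hom V (principal_sum k s)), forall n, injective (j n).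
Proof.
move=> fgV tV; have [|n x [p [a /tV//]]|chi chiE] := @cogeneration k V (fun n x => x = 0) fgV.
  by split=> [//|p c u v -> ->|p q b u ->]; rewrite ?scaler0 ?addr0 ?act0.
by exists (map tag chi), (tuple_hom chi); apply: hom_inj => n x /tuple_hom_eq0/chiE.
Qed.

(** Descent holds in a sum of principal modules containing [V], and [V] is
    closed in this sum. *)
Lemma saturated_sheaf (V : Cmod k) : finitely_generated V -> saturated V -> sheaf V.
Proof.
move=> fgV satV; have tV := saturated_torsion_free satV; split=> // m n a y desc.
have [s [j ij]] := principal_embedding fgV tV.
have [tI dI] := sheaf_principal_sum k s.
have [p b b' /desc bb'|x xE] := dI m n a (j n y).
  by rewrite -!hom_nat bb'.
have [|v vx] := saturated_closed satV tI ij (x := x).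
  by exists n, a, y.
by exists v; apply: (ij n); rewrite hom_nat vx.
Qed.

Lemma sa_sheaf (V : sa_mod k) : sheaf V.
Proof. exact: saturated_sheaf (sa_fg V) (@sa_sat _ V). Qed.

Definition principal_sum_sa s : sa_mod k :=
  MkSaMod (noetherian_fg (@noetherian_principal_sum k s))
    (sheaf_saturated (sheaf_principal_sum k s)).

Definition principal_sa d : sa_mod k :=
  MkSaMod (noetherian_fg (@noetherian_principal k d))
    (sheaf_saturated (sheaf_principal k d)).

(** Monomorphisms are tested on the saturated modules [M(n)]. *)
Lemma mono_inj (A B : sa_mod k) (f : hom A B) : is_mono f -> forall n, injective (f n).
Proof.
move=> mf; apply: hom_inj => n x fx.
have := mf (principal_sa n) (of_elt x) (zero_hom _ _) _ n (delta k (incr_id n)).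
rewrite of_elt_id; apply=> m c; rewrite !hom_compE hom_of_elt fx zero_homE hom0.
by rewrite of_eltE big1 // => g _; rewrite act0 scaler0.
Qed.

Lemma inj_mono (A B : sa_mod k) (f : hom A B) : (forall n, injective (f n)) -> is_mono f.
Proof. by move=> fi X u v uv n x; apply: (fi n); apply: uv. Qed.

Section Kernels.
Variables (A : sa_mod k) (W : Cmod k) (f : hom A W) (tW : torsion_free W).

Definition ker_sa : sa_mod k :=
  MkSaMod (noetherian_fg (noetherian_sub (sP := subm_ker f) (fg_noetherian (sa_fg A))))
    (sheaf_saturated (sheaf_ker f (sa_sheaf A) tW)).

Definition ker_incl : hom ker_sa A := sub_incl (subm_ker f).

Lemma ker_inclE n x : f n (ker_incl n x) = 0.
Proof. exact: (sub_inclP x). Qed.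

Lemma ker_incl_surj n x : f n x = 0 -> exists y, ker_incl n y = x.
Proof. exact: (@sub_incl_surj _ _ _ (subm_ker f)). Qed.

Lemma ker_incl_inj n : injective (ker_incl n).
Proof. exact: (@sub_incl_inj _ _ _ (subm_ker f)). Qed.

Lemma ker_lift (X : sa_mod k) (u : hom X A) : (forall n x, f n (u n x) = 0) ->
  exists v : hom X ker_sa, forall n x, ker_incl n (v n x) = u n x.
Proof. exact: (@sub_lift _ _ _ _ (subm_ker f)). Qed.
End Kernels.

Lemma sa_torsion_free (A : sa_mod k) : torsion_free A.
Proof. by have [] := sa_sheaf A. Qed.

Lemma ker_is_kernel (A B : sa_mod k) (f : hom A B) :
  is_kernel f (ker_incl f (sa_torsion_free (A := B))).
Proof.
split=> [n x|X u fu]; first exact: ker_inclE.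
have [v vE] := ker_lift (sa_torsion_free (A := B)) fu.
exists v; split=> [|w wu n x]; first exact: vE.
by apply: (@ker_incl_inj _ _ f (sa_torsion_free (A := B))); rewrite vE; apply: wu.
Qed.

Definition im (V W : Cmod k) (f : hom V W) n (y : W n) : Prop :=
  exists2 x, True & f n x = y.

Lemma im_subm (V W : Cmod k) (f : hom V W) : is_subm (im f).
Proof. exact/subm_im/subm_all. Qed.

Lemma dense_eq (A B X : sa_mod k) (f : hom A B) (u v : hom B X) :
  (forall n y, closure (im f) (n := n) y) ->
  hom_eq (hom_comp u f) (hom_comp v f) -> hom_eq u v.
Proof.
move=> df uv n y; have [p [a [x _ xy]]] := df n y.
apply: (torsion_free_eq (a := a) (sa_torsion_free (A := X))).
by rewrite -!hom_nat -xy; apply: uv.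
Qed.

(** In the category of saturated modules a dense image is the whole kernel. *)
Lemma exact_atP (A B C : sa_mod k) (f : hom A B) (g : hom B C) :
  is_zero_hom (hom_comp g f) -> (forall n y, g n y = 0 -> closure (im f) (n := n) y) ->
  exact_at f g.
Proof.
move=> gf kg; pose tC := sa_torsion_free (A := C).
have [e eE] := ker_lift tC gf.
exists (ker_sa g tC), (ker_incl g tC), e; split=> [||n x]; first exact: ker_is_kernel.
  move=> X u v; apply: dense_eq => n y.
  have [p [a [x _ xy]]] := kg n _ (ker_inclE y).
  exists p, a, x => //; apply: (@ker_incl_inj _ _ g tC).
  by rewrite eE hom_nat.
by rewrite hom_compE eE.
Qed.

Lemma injective_principal_sum s : injective_object (principal_sum_sa s).
Proof.
move=> A B i f /mono_inj ii; elim: s f => [|d s IH] f.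
  by exists (zero_hom _ _) => n x; rewrite [LHS]thinmx0 [RHS]thinmx0.
have [g2 g2E] := IH (hom_comp (snd_hom _ _) f).
pose f1 := hom_comp (fst_hom _ _) f.
have [|g1 g1E] := @extend_hom k d B (im (pair_hom i f1)) (sa_fg B) (im_subm _).
  move=> n y [x _ [ix <-]]; have -> : x = 0 by apply: (ii n); rewrite hom0 -ix.
  by rewrite hom0.
exists (pair_hom g1 g2) => n x.
rewrite hom_compE pair_homE (g1E n _ (f1 n x)); last by exists x.
have := g2E n x; rewrite hom_compE => ->.
by rewrite [RHS]surjective_pairing.
Qed.

(** There are no nonzero morphisms from [M(d)] to [M(e)] for [d < e], and the
    endomorphisms of [M(d)] are the scalars. *)
Lemma principal_hom_inj d e (h : hom (principal k d) (principal k e)) : (d <= e)%N ->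
  ~ is_zero_hom h -> forall n x, h n x = 0 -> x = 0.
Proof.
rewrite leq_eqVlt => /orP[/eqP de|de] nh n x hx; last first.
  case: nh => m c; rewrite hom_principal.
  have -> : h d (delta k (incr_id d)) = 0.
    by apply/ffunP => g; have := incr_leq g; rewrite leqNgt de.
  by rewrite of_eltE big1 // => g _; rewrite act0 scaler0.
subst e; pose c : k := h d (delta k (incr_id d)) (incr_id d).
have hE m y : h m y = c *: y.
  rewrite hom_principal (delta_sum (h d _)) (sum_single (j := incr_id d)); last first.
    by move=> g; rewrite (incr_endo g) eqxx.
  rewrite of_eltE -/c [in RHS](delta_sum y) scaler_sumr; apply: eq_bigr => g _.
  by rewrite actZ delta_act incr_compf1 !scalerA mulrC.
have [c0|c0] := eqVneq c 0; first by case: nh => m y; rewrite hE c0 scale0r.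
by apply/eqP; move/eqP: hx; rewrite hE scaler_eq0 (negPf c0).
Qed.

(** If a morphism [h] on the sum is nonzero on some summand, it is injective
    there, so that the component of the tuple in this summand is determined by
    the other components and the value of [h]. *)
Lemma dependency (W : Cmod k) (chi : seq {e & hom W (principal k e)}) e
    (h : hom (principal_sum k (map tag chi)) (principal k e)) :
  (forall f, List.In f chi -> (tag f <= e)%N) -> ~ is_zero_hom h ->
  exists l1 f l2, chi = l1 ++ f :: l2 /\ forall n x, killed_by (l1 ++ l2) x ->
    h n (tuple_hom chi n x) = 0 -> tagged f n x = 0.
Proof.
elim: chi h => [|f chi IH] h chie nh.
  by case: nh => n x; rewrite (thinmx0 x) [LHS]hom0.
pose V := principal_sum k (map tag chi).
pose h1 : hom (principal k (tag f)) _ := hom_comp h (pair_hom (hom_id _) (zero_hom _ V)).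
pose h2 : hom V _ := hom_comp h (pair_hom (zero_hom V (principal k (tag f))) (hom_id V)).
have hE n y z : h n (y, z) = h1 n y + h2 n z.
  rewrite -[h1 n y]/(h n (y, 0)) -[h2 n z]/(h n (0, z)) -homD.
  by rewrite -[(y, 0) + _]/(y + 0, 0 + z) addr0 add0r.
have [h20|nh2] := pselect (is_zero_hom h2).
  exists [::], f, chi; split=> // n x _.
  rewrite -[tuple_hom _ _ _]/(tagged f n x, tuple_hom chi n x) hE h20 addr0.
  apply: principal_hom_inj; first by apply: chie; left.
  by move=> h10; apply: nh => m [y z]; rewrite hE h10 h20 addr0.
have [l1 [g [l2 [chiE gE]]]] := IH h2 (fun f' fchi => chie f' (or_intror fchi)) nh2.
exists (f :: l1), g, l2; split=> [|n x kx]; first by rewrite chiE.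
have fx : tagged f n x = 0 by apply: kx; left.
rewrite -[tuple_hom _ _ _]/(tagged f n x, tuple_hom chi n x) hE fx hom0 add0r.
by apply: gE => u ul; apply: kx; right.
Qed.

(** The right module dual to the cokernel of [f], whose part of degree [e] is
    the space of morphisms from this cokernel to [M(e)], lives in degrees less
    than [N]. *)
Definition level (A B : sa_mod k) (f : hom A B) N : Prop :=
  forall e (h : hom B (principal k e)), (N <= e)%N -> is_zero_hom (hom_comp h f) ->
    is_zero_hom h.

Definition resolves (A B I : sa_mod k) (f : hom A B) N (g : hom B I) : Prop :=
  [/\ injective_object I, is_zero_hom (hom_comp g f),
      forall n y, g n y = 0 -> closure (im f) (n := n) y,
      level g N.-1 & N = 0%N -> is_zero I].

(** Take a family of morphisms to principal modules, of minimal size among those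
    whose common kernel is the closure of the image of [f]. No member is
    redundant; so all of them have targets [M(e)] with [e < N], and a morphism
    from the sum to [M(e)] with [N - 1 <= e] that kills the family is zero, as
    it would express one member by the others. *)
Lemma resolution_step (A B : sa_mod k) (f : hom A B) N : level f N ->
  exists (I : sa_mod k) (g : hom B I), resolves f N g.
Proof.
move=> levf; pose J := closure (im f).
pose sep (chi : seq {e & hom B (principal k e)}) :=
  forall n (x : B n), killed_by chi x <-> J n x.
have sepP : exists m, `[< exists2 chi, sep chi & size chi = m >].
  have [chi chiE] := cogeneration (sa_fg B) (closure_subm (im_subm f)) (@closure_closed _ _ _).
  by exists (size chi); apply/asboolP; exists chi.
case: (ex_minnP sepP) => m /asboolP[chi sep_chi <-] min_chi {sepP m}.
have irred l1 h l2 : chi = l1 ++ h :: l2 ->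
    ~ (forall n x, killed_by (l1 ++ l2) x -> tagged h n x = 0).
  move=> chiE hx; suff /min_chi : `[< exists2 chi', sep chi' & size chi' = size (l1 ++ l2) >].
    by rewrite chiE !size_cat /= addnS ltnn.
  apply/asboolP; exists (l1 ++ l2) => // n x; rewrite -sep_chi chiE.
  split=> kx u ul; last first.
    apply: kx; apply: List.in_or_app; case: (List.in_app_or _ _ _ ul); first by left.
    by right; right.
  case: (List.in_app_or _ _ _ ul) => [ul1|[<-|ul2]].
  - by apply: kx; apply: List.in_or_app; left.
  - exact: hx.
  - by apply: kx; apply: List.in_or_app; right.
have tagN h : List.In h chi -> (tag h < N)%N.
  move=> hchi; rewrite ltnNge; apply/negP => Nh.
  have [l1 [l2 chiE]] := List.in_split _ _ hchi.
  apply: (irred l1 h l2 chiE) => n x _; apply: levf => // p a.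
  have /sep_chi : J p (f p a) by apply: closure_sub; exists a.
  exact.
exists (principal_sum_sa (map tag chi)), (tuple_hom chi); split.
- exact: injective_principal_sum.
- by move=> n x; apply/tuple_hom_eq0/sep_chi/closure_sub; exists x.
- by move=> n y /tuple_hom_eq0/sep_chi.
- move=> e h Ne hchi; apply: contrapT => nh.
  have [|l1 [g [l2 [chiE gE]]]] := dependency _ nh.
    by move=> u /tagN; lia.
  by apply: (irred l1 g l2 chiE) => n x kx; apply: gE => //; apply: hchi.
- move=> N0; case: (chi) tagN => [_ n x|h l /(_ h (or_introl erefl))]; last by rewrite N0.
  by rewrite hom_idE; apply: (thinmx0 x).
Qed.

Record stage := Stage {
  stage_src : sa_mod k;
  stage_tgt : sa_mod k;
  stage_hom : hom stage_src stage_tgt;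
  stage_level : nat;
  stageP : level stage_hom stage_level
}.

Section Next.
Variable s : stage.
Definition next_obj : sa_mod k := projT1 (cid (resolution_step (@stageP s))).
Definition next_hom : hom (stage_tgt s) next_obj :=
  projT1 (cid (projT2 (cid (resolution_step (@stageP s))))).
Lemma next_resolves : resolves (stage_hom s) (stage_level s) next_hom.
Proof. exact: projT2 (cid (projT2 (cid (resolution_step (@stageP s))))). Qed.
Lemma next_level : level next_hom (stage_level s).-1.
Proof. by case: next_resolves. Qed.
Definition next : stage := Stage next_level.
End Next.

(** A morphism to [M(e)] kills all generators of degree less than [e]. *)
Lemma finite_level (A B : sa_mod k) (f : hom A B) : exists N, level f N.
Proof.
have [l [_ gl]] := fg_noetherian (sa_fg B) (@subm_all _ B).
have [N lN] : exists N, forall g, List.In g l -> (tag g < N)%N.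
  elim: (l) => [|g l' [N lN]]; first by exists 0%N.
  by exists (maxn (tag g).+1 N) => h [<-|/lN]; lia.
exists N => e h Ne _ n x; apply: (gl _ (subm_ker h)) => // g /lN gN.
by apply/ffunP => q; have := incr_leq q; lia.
Qed.

Theorem sa_finite_injective_dimension (V : sa_mod k) : finite_injective_dimension V.
Proof.
have [N levN] := finite_level (zero_hom V V).
pose chain j := iter j next (Stage levN).
have chain_level j : stage_level (chain j) = (N - j)%N.
  by elim: j => [|j IH]; rewrite ?subn0 // subnS -IH.
pose I j := next_obj (chain j).
pose del j : hom (I j) (I j.+1) := next_hom (chain j.+1).
exists N, I, (next_hom (Stage levN)), del; split=> [j||||j Nj].
- by have [] := next_resolves (chain j).
- apply/inj_mono/hom_inj => n x.
  have [_ _ H _ _] := next_resolves (Stage levN) => /H[p [a [y _]]].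
  by rewrite zero_homE => /esym/sa_torsion_free.
- by have [_ gf kg _ _] := next_resolves (chain 1%N); apply: exact_atP.
- by move=> j; have [_ gf kg _ _] := next_resolves (chain j.+2); apply: exact_atP.
- by have [_ _ _ _] := next_resolves (chain j); apply; rewrite chain_level; lia.
Qed.

Section Simple.
Variable d : nat.
Let sS := @socle_subm k d.

Lemma socle_sheaf : sheaf (sub_cmod sS).
Proof.
apply: sheaf_sub (sheaf_principal k d) _ => m n a x sx e q ed.
by apply: (@principal_torsion_free _ _ _ _ a); rewrite -hom_nat; apply: sx.
Qed.

Definition socle_sa : sa_mod k :=
  MkSaMod (noetherian_fg (noetherian_sub (sP := sS) (@noetherian_principal k d)))
    (sheaf_saturated socle_sheaf).

Definition socle_incl : hom socle_sa (principal k d) := sub_incl sS.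

Lemma socle_incl_inj n : injective (socle_incl n).
Proof. exact: (@sub_incl_inj _ _ _ sS). Qed.

Lemma socle_sa_dense (V : Cmod k) (f : hom V socle_sa) : ~ is_zero_hom f ->
  forall n y, closure (im f) (n := n) y.
Proof.
move=> nf n y; have /existsNP[m /existsNP[x fx]] := nf.
have [||||p [a [z _ az]]] := @socle_dense k d (im (hom_comp socle_incl f)) m
  (socle_incl m (f m x)) n (socle_incl n y).
- exact: im_subm.
- by exists x.
- by apply/eqP; rewrite -(hom0 socle_incl) => /socle_incl_inj.
- exact: (sub_inclP y).
by exists p, a, z => //; apply: socle_incl_inj; rewrite hom_nat -az hom_compE.
Qed.

(** A nonzero subobject is dense in the socle, and closed by descent. *)
Lemma socle_simple : simple_object socle_sa.
Proof.
split=> [S0|A i /mono_inj ii].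
  have [x xc] := @sub_incl_surj _ _ _ sS _ _ (@cube_socle k d).
  have := cube_neq0 k d; rewrite -xc.
  by have := S0 _ x; rewrite hom_idE => ->; rewrite hom0 eqxx.
have [A0|nA] := pselect (is_zero A); [by left | right].
have ni : ~ is_zero_hom i.
  by move=> i0; apply: nA => n x; rewrite hom_idE; apply: (ii n); rewrite i0 hom0.
have [_ dA] := sa_sheaf A; have tS := sa_torsion_free (A := socle_sa).
have isurj n y : exists x, i n x = y.
  have [p [a [b _ ab]]] := socle_sa_dense ni y.
  have [q c c' cc'|x xb] := dA n p a b.
    by apply: (ii q); rewrite !hom_nat ab -!act_comp cc'.
  by exists x; apply: (torsion_free_eq (a := a) tS); rewrite -hom_nat xb.
pose G n (y : dsum socle_sa A n) := im (pair_hom i (hom_id A)) y.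
have [n y [x _ [ix <-]]|n y|g gE] := @graph_hom _ _ _ G (im_subm _).
- by apply: (ii n); rewrite hom0; apply: ix.
- by have [x ix] := isurj n y; exists x, x; rewrite // pair_homE ix.
have gi n x : g n (i n x) = x by apply/gE; exists x.
exists g; split=> n x; first exact: gi.
by have [y <-] := isurj n x; rewrite hom_compE gi.
Qed.

(** The universal property extends a morphism from the dense image of [p] to
    the whole target by descent. *)
Lemma dense_cokernel (A X S : sa_mod k) (i : hom A X) (p : hom X S) :
  is_kernel p i -> (forall n x, p n x = 0 -> exists y, i n y = x) ->
  (forall n y, closure (im p) (n := n) y) -> short_exact i p.
Proof.
move=> ker_pi pi dp; split=> //; split=> [|Y u ui]; first by case: ker_pi.
have [tY dY] := sa_sheaf Y.
have up n x : p n x = 0 -> u n x = 0 by move=> /pi[y <-]; apply: ui.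
pose G := closure (im (pair_hom p u)).
have sG : is_subm G by apply/closure_subm/im_subm.
have [n y [q [a [x _ [px ux]]]]|n y|v vE] := graph_hom sG.
- by apply: (tY _ _ a); rewrite -ux up // px act0.
- have [q [a [x _ xy]]] := dp n y.
  have [r b b' bb'|z zx] := dY n q a (u q x).
    rewrite -!hom_nat; apply/eqP; rewrite -subr_eq0 -homB; apply/eqP/up.
    by rewrite homB !hom_nat xy -!act_comp bb' subrr.
  by exists z, q, a, x; rewrite // pair_homE xy -zx.
have vp n x : v n (p n x) = u n x.
  by apply/vE; apply: closure_sub; exists x.
exists v; split=> [n x|w wp]; first exact: vp.
by apply: dense_eq dp _ => n x; rewrite !hom_compE vp; apply: wp.
Qed.

End Simple.

(** The first morphism of the tower that does not vanish on [X] has dense image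
    in a simple object, and its kernel is left with a shorter tower. *)
Lemma tower_finite_length (W : Cmod k) l (P : forall n, W n -> Prop) : tower P l ->
  forall (X : sa_mod k) (j : hom X W), (forall n, injective (j n)) ->
    (forall n x, P n (j n x)) -> finite_length X.
Proof.
elim: l P => [|[d f] l IH] P /=.
  move=> P0 X j ij Pj; apply: finite_length_zero => n x; rewrite hom_idE.
  by apply: (ij n); rewrite hom0; apply/P0/Pj.
move=> [Pf tl] X j ij Pj.
have [|p pE] := sub_lift (@socle_subm k d) (u := hom_comp f j).
  by move=> n x; apply/Pf/Pj.
have [p0|np] := pselect (is_zero_hom (p : hom X (socle_sa d))).
  apply: (IH _ tl X j ij) => n x; split; first exact: Pj.
  by rewrite -[LHS]/(hom_comp f j n x) -pE p0 hom0.
pose tS := sa_torsion_free (A := socle_sa d).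
pose q : hom X (socle_sa d) := p.
apply: (@finite_length_step _ (ker_sa q tS) X (socle_sa d) (ker_incl q tS) q).
- apply: dense_cokernel; first exact: ker_is_kernel.
    by move=> n x /(ker_incl_surj tS).
  exact: socle_sa_dense.
- exact: socle_simple.
apply: (IH _ tl _ (hom_comp j (ker_incl q tS))) => [n|n x].
  by move=> x y /ij/ker_incl_inj.
split; first exact: Pj.
by rewrite -[LHS]/(hom_comp f j n _) -pE -/q ker_inclE hom0.
Qed.

Theorem sa_finite_length (V : sa_mod k) : finite_length V.
Proof.
have [s [j ij]] := principal_embedding (sa_fg V) (sa_torsion_free (A := V)).
have [l tl] := tower_principal_sum k s.
exact: (tower_finite_length tl ij).
Qed.

End Saturated.

Theorem corollary4p7 (k : fieldType) (V : sa_mod k) :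
  finite_length V /\ finite_injective_dimension V.
Proof.
by split; [apply: sa_finite_length | apply: sa_finite_injective_dimension].
Qed.
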